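(* Suppose $g=\mathbf{P}\mu$, where $\mu\in L^\infty(\mathbb{D})$, and for $0<r<1$ let $g_r$ denote the dilate $g_r(\zeta):=g(r\zeta)$. Then $$\limsup_{r\to1^-}\frac{\int_{\mathbb{T}}|g_r|^2\,\mathrm{d}s}{\log\frac{1}{1-r^2}}\le(1-\rho_{\mathbb{H}})\,\|\mu\|_{L^\infty(\mathbb{D})}^2 .$$
   Context: $\mathbb{D}$ is the open unit disk, $\mathbb{T}=\partial\mathbb{D}$, $\mathbb{D}(0,r)=\{z\in\mathbb{C}:|z|<r\}$; $\mathrm{d}A(z)=\frac{1}{\pi}\mathrm{d}x\,\mathrm{d}y$ is normalized area measure and $\mathrm{d}s(z)=\frac{|\mathrm{d}z|}{2\pi}$ is normalized arc length measure. The Bergman projection of $\mu\in L^1(\mathbb{D})$ is $$\mathbf{P}\mu(z):=\int_{\mathbb{D}}\frac{\mu(w)}{(1-z\bar w)^2}\,\mathrm{d}A(w),\qquad z\in\mathbb{D}.$$ The minimal discrepancy density for hyperbolic zero packing is $$\rho_{\mathbb{H}}:=\liminf_{r\to1^-}\ \inf_f\ \frac{1}{\log\frac{1}{1-r^2}}\int_{\mathbb{D}(0,r)}\big((1-|z|^2)|f(z)|-1\big)^2\,\frac{\mathrm{d}A(z)}{1-|z|^2},$$ where the infimum runs over all polynomials $f$ with complex coefficients. *)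

(* Defs.v *)
From mathcomp Require Import all_boot all_order all_algebra.
From mathcomp Require Import all_classical all_reals all_analysis.
From mathcomp Require Import ess_sup_inf.
From mathcomp Require Import complex.

Set Implicit Arguments.
Unset Strict Implicit.
Unset Printing Implicit Defensive.

Import Order.TTheory GRing.Theory Num.Theory.
Import numFieldNormedType.Exports.

Local Open Scope classical_set_scope.
Local Open Scope ring_scope.
Local Open Scope complex_scope.

(* The norm of the ring [R[i]] takes values in [R[i]]; this is the
   [R]-valued modulus. *)
Notation cmod := (@ComplexField.Normc.normc _).

(* [R[i]] carries no measurable structure, so C is integrated over through its
   real and imaginary coordinates. *)
Notation plane R := (measurableTypeR R * measurableTypeR R)%type.

Definition to_complex (R : realType) (p : plane R) : R[i] := p.1 +i* p.2.

Definition disk (R : realType) (r : R) : set (plane R) :=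
  [set p | cmod (to_complex p) < r].

Lemma pi_inv_ge0 (R : realType) : 0 <= (pi : R)^-1.
Proof. by rewrite invr_ge0 pi_ge0. Qed.

(* dA = dx dy / pi *)
Definition area (R : realType) : {measure set (plane R) -> \bar R} :=
  mscale (NngNum (pi_inv_ge0 R)) (lebesgue_measure \x lebesgue_measure)%E.

Definition cintegral (R : realType) (D : set (plane R)) (F : R[i] -> R[i]) :
    R[i] :=
  Rintegral (area R) D (fun p => complex.Re (F (to_complex p))) +i*
  Rintegral (area R) D (fun p => complex.Im (F (to_complex p))).

Definition bergman (R : realType) (mu : R[i] -> R[i]) (z : R[i]) : R[i] :=
  cintegral (disk 1) (fun w => mu w / (1 - z * w^*) ^+ 2).

(* Extension by zero off the unit disk does not change the essential supremum
   of a modulus. *)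
Definition Linfty_norm (R : realType) (mu : R[i] -> R[i]) : \bar R :=
  ess_sup (area R) (EFin \o ((fun p => cmod (mu (to_complex p))) \_ (disk 1))).

Definition in_Linfty (R : realType) (mu : R[i] -> R[i]) : Prop :=
  [/\ measurable_fun (disk 1) (fun p : plane R => complex.Re (mu (to_complex p))),
      measurable_fun (disk 1) (fun p : plane R => complex.Im (mu (to_complex p)))
    & (Linfty_norm mu < +oo)%E].

(* Integral over the unit circle against ds = |dz| / (2 pi), through the
   parametrization z = exp (i t), 0 <= t <= 2 pi. *)
Definition circle_integral (R : realType) (F : R[i] -> R) : \bar R :=
  ((2 * pi)^-1%:E *
   \int[lebesgue_measure]_(t in `[0%R, (2 * pi)%R]) (F (cos t +i* sin t))%:E)%E.

Definition dilate (R : realType) (g : R[i] -> R[i]) (r : R) (zeta : R[i]) : R[i] :=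
  g (r%:C * zeta).

Definition log_weight (R : realType) (r : R) : R := ln (1 / (1 - r ^+ 2)).

Definition discrepancy (R : realType) (r : R) (f : {poly R[i]}) : \bar R :=
  ((log_weight r)^-1%:E *
   \int[area R]_(p in disk r)
     (((1 - cmod (to_complex p) ^+ 2) * cmod f.[to_complex p] - 1) ^+ 2
        / (1 - cmod (to_complex p) ^+ 2))%:E)%E.

(* Minimal discrepancy density for hyperbolic zero packing. *)
Definition rhoH (R : realType) : \bar R :=
  limf_einf (fun r : R => ereal_inf (range (@discrepancy R r))) (1 : R)^'-.

(* Main.v *)
From HB Require Import structures.
Require Import Defs.
From mathcomp Require Import all_boot all_order all_algebra.
From mathcomp Require Import all_classical all_reals all_analysis.
From mathcomp Require Import measurable_realfun ess_sup_inf.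
From mathcomp Require Import complex.
From mathcomp Require Import ring lra.

(** Let [g] be the Bergman projection of [mu], with Taylor coefficients [a n], and
    let [M] be the norm of [mu]. The theorem is a duality argument, carried out for
    each fixed [0 < r < 1] with the infimum [rho_r] of the discrepancy over the
    disk of radius [r].

    The partial sums [S] of the mean square [sum |a n|^2 r^(2 n)] of [g] on the
    circle of radius [r] are pairings of [mu] with the polynomials of coefficients
    [(n + 1) a n r^(2 n)], so [S] is at most [M] times the integral over the unit
    disk of the modulus of such a polynomial ([bergman_coef_duality]). A dilation
    turns this integral into [r^-2] times the integral [B] over the disk of radius
    [r] of [|H|], where [H] has coefficients [(n + 1) a n r^n]
    ([Rintegral_disk_dilation]).

    Expanding the square in the discrepancy of [c H] gives, with [L] the
    logarithmic weight and [A] the integral of [(1 - |z|^2) |H|^2] over the disk of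
    radius [r], the inequality [rho_r L <= c^2 A - 2 c B + L]
    ([rho_at_quadratic]). The number [A] is computed by Parseval's identity
    ([integral_disk_weighted]), and Bernoulli's inequality shows [A <= S] exactly,
    without error term. Choosing [c = r^2 / M] yields
    [S <= (M / r^2)^2 (1 - rho_r) L] ([bergman_coef_bound]). Only partial sums are
    involved, so [H] is a genuine polynomial; the mean square of [g] itself is
    reached by Fatou's lemma ([circle_integral_bergman_le]). Dividing by [L] and
    taking the upper limit gives the theorem.

    Polar coordinates are replaced by two facts about planar Lebesgue measure:
    rotations, being products of shears, preserve it ([scales_area_rotation]), and
    the image of normalized area under the squared modulus is Lebesgue measure on
    the half-line ([ge0_integral_radial]). Averaging over rotations reduces
    Parseval's identity on the plane to the one on the circle
    ([ge0_integral_radial_parseval]). *)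

Set Implicit Arguments.
Unset Strict Implicit.
Unset Printing Implicit Defensive.

Import Order.TTheory GRing.Theory Num.Theory.
Import numFieldNormedType.Exports.

Local Open Scope classical_set_scope.
Local Open Scope ring_scope.
Local Open Scope complex_scope.

(* Conjugation is always written through [conjc]; [Num.conj] on [R[i]] is
   convertible to it. *)
Local Notation "x ^*" := (conjc x) : ring_scope.

(** * Planar Lebesgue measure under shears, rotations and homotheties *)

(** The image measure, as a bundled measure, of a map known to be measurable. *)
Definition image_measure d d' (T1 : measurableType d) (T2 : measurableType d')
    (R : realType) (m : {measure set T1 -> \bar R}) (f : T1 -> T2)
    (mf : measurable_fun setT f) : {measure set T2 -> \bar R} :=
  ltac:(refine (pushforward m f : {measure set T2 -> \bar R}); exact: mf).

Section planar_measure.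
Context {R : realType}.
Local Notation T := (measurableTypeR R).
Local Notation lam := (@lebesgue_measure R).
Local Notation lam2 := (lam \x lam)%E.

Lemma measurable_affine (r b : R) :
  measurable_fun [set: T] (fun x : T => r * x + b : T).
Proof. by apply: measurable_funD => //; exact: measurable_funM. Qed.

Lemma lebesgue_measure_affine (r b : R) (A : set T) : 0 < r -> measurable A ->
  lam A = (r%:E * lam ((fun x : T => (r * x + b)%R : T) @^-1` A))%E.
Proof.
move=> r0 mA.
apply: (lebesgue_measure_unique (mu := mscale (NngNum (ltW r0))
  (image_measure lam (measurable_affine r b)))) => //=.
move=> _ [[u v]] _ <- /=; rewrite /mscale /image_measure /pushforward /=.
rewrite (_ : pushforward _ _ _ = lam `](u - b) / r, (v - b) / r]%classic); last first.
  congr (lam _); apply/seteqP; split => x /=; rewrite !in_itv/= ltr_pdivrMr// ler_pdivlMr//;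
    by rewrite ltrBlDr lerBrDr mulrC.
rewrite !lebesgue_measure_itv/= !lte_fin ltr_pM2r ?invr_gt0// ltrD2r.
case: ifPn => uv; last by rewrite mule0.
rewrite -!EFinD -EFinM; congr EFin; field.
by rewrite gt_eqF.
Qed.

(** [phi] multiplies Lebesgue measure by [c]: preimages under [phi] have
    measure divided by [c]. *)
Definition scales_area (c : R) (phi : plane R -> plane R) :=
  measurable_fun setT phi /\
  forall X, measurable X -> lam2 X = (c%:E * lam2 (phi @^-1` X))%E.

Lemma scales_area_comp c d phi psi : scales_area c phi -> scales_area d psi ->
  scales_area (c * d) (phi \o psi).
Proof.
move=> [mphi phiE] [mpsi psiE]; split; first exact: measurableT_comp.
move=> X mX; rewrite phiE// psiE ?EFinM ?muleA//.
by rewrite -[X in measurable X]setTI; exact: mphi.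
Qed.

Lemma scales_area_shear1 (c : R) :
  scales_area 1 (fun p : plane R => (p.1 + c * p.2, p.2)).
Proof.
have mphi : measurable_fun setT (fun p : plane R => (p.1 + c * p.2, p.2) : plane R).
  apply: measurable_fun_pair => //; apply: measurable_funD => //.
  exact: measurable_funM.
split => // X mX; rewrite mul1e.
have lam2E Y : measurable Y -> lam2 Y = (lam \x^ lam)%E Y.
  move=> mY; apply: product_measure_unique => // A B mA mB.
  exact: product_measure2E.
rewrite !lam2E//; last by rewrite -[X in measurable X]setTI; exact: mphi.
apply: eq_integral => y _ /=.
rewrite (@lebesgue_measure_affine 1 (c * y))//; last exact: measurable_ysection.
rewrite mul1e; congr (lam _); apply/seteqP; split => x /=;
  by rewrite /ysection/= !inE/= mul1r.
Qed.

Lemma scales_area_shear2 (c : R) :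
  scales_area 1 (fun p : plane R => (p.1, p.2 + c * p.1)).
Proof.
have mphi : measurable_fun setT (fun p : plane R => (p.1, p.2 + c * p.1) : plane R).
  apply: measurable_fun_pair => //; apply: measurable_funD => //.
  exact: measurable_funM.
split => // X mX; rewrite mul1e.
apply: eq_integral => x _ /=.
rewrite (@lebesgue_measure_affine 1 (c * x))//; last exact: measurable_xsection.
rewrite mul1e; congr (lam _); apply/seteqP; split => y /=;
  by rewrite /xsection/= !inE/= mul1r.
Qed.

Lemma scales_area_rotation (a b : R) : a ^+ 2 + b ^+ 2 = 1 ->
  scales_area 1 (fun p : plane R => (a * p.1 - b * p.2, b * p.1 + a * p.2)).
Proof.
(* The rotations other than the half turn are products of three shears. *)
have gen (u v : R) : u != -1 -> u ^+ 2 + v ^+ 2 = 1 ->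
    scales_area 1 (fun p : plane R => (u * p.1 - v * p.2, v * p.1 + u * p.2)).
  move=> u1 uv1; have u10 : 1 + u != 0 by rewrite addrC addr_eq0.
  have := scales_area_comp (scales_area_shear1 (- v / (1 + u)))
    (scales_area_comp (scales_area_shear2 v) (scales_area_shear1 (- v / (1 + u)))).
  rewrite !mulr1; congr (scales_area _ _); apply/funext => -[x y] /=.
  have v2 : v ^+ 2 = (1 - u) * (1 + u) by apply: (addrI (u ^+ 2)); rewrite uv1; ring.
  congr pair.
    have -> : x + - v / (1 + u) * y + - v / (1 + u) * (y + v * (x + - v / (1 + u) * y))
      = x * (1 - v ^+ 2 / (1 + u)) + y * (- v / (1 + u)) * (2 - v ^+ 2 / (1 + u)).
      by field.
    by rewrite v2; field.
  have -> : y + v * (x + - v / (1 + u) * y) = v * x + (1 - v ^+ 2 / (1 + u)) * y.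
    by field.
  by rewrite v2; field.
move=> ab1; have [aN1|aN1] := eqVneq a (-1); last exact: gen.
have b0 : b = 0.
  move: ab1; rewrite aN1 sqrrN expr1n => /eqP.
  by rewrite addrC -subr_eq0 addrK sqrf_eq0 => /eqP.
(* The half turn is the square of a quarter turn. *)
have q : scales_area 1 (fun p : plane R => (0 * p.1 - 1 * p.2, 1 * p.1 + 0 * p.2)).
  by apply: gen; rewrite ?expr0n ?expr1n ?add0r// eq_sym oppr_eq0 oner_eq0.
have := scales_area_comp q q; rewrite mulr1; congr (scales_area _ _).
by apply/funext => -[x y] /=; rewrite aN1 b0; congr pair; ring.
Qed.

Lemma scales_area_homothety (r : R) : 0 < r ->
  scales_area (r ^+ 2) (fun p : plane R => (r * p.1, r * p.2)).
Proof.
move=> r0.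
have mphi : measurable_fun setT (fun p : plane R => (r * p.1, r * p.2) : plane R).
  by apply: measurable_fun_pair => //; exact: measurable_funM.
split => // X mX.
apply: (product_measure_unique (m' := mscale (NngNum (sqr_ge0 r))
  (image_measure lam2 mphi))) => //= A B mA mB.
rewrite /mscale /pushforward /=.
rewrite (lebesgue_measure_affine 0 r0 mA) (lebesgue_measure_affine 0 r0 mB).
rewrite (_ : pushforward _ _ _ = lam2 (((fun x : T => r * x + 0 : T) @^-1` A)
  `*` ((fun x : T => r * x + 0 : T) @^-1` B))); last first.
  by congr (lam2 _); apply/seteqP; split => -[x y] /=; rewrite !addr0.
have mr := measurable_affine r 0.
rewrite product_measure1E; first by rewrite muleACA -EFinM expr2.
- by rewrite -[X in measurable X]setTI; exact: mr.
- by rewrite -[X in measurable X]setTI; exact: mr.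
Qed.

End planar_measure.

(** * Area integrals of radial functions *)

(** Change of variables for a map under which the measure of a set is [c] times
    that of its preimage. *)
Lemma ge0_integral_image_scale d d' (X : measurableType d) (Y : measurableType d')
    (R : realType) (m1 : {measure set X -> \bar R}) (m2 : {measure set Y -> \bar R})
    (phi : X -> Y) (c : R) (D : set Y) (f : Y -> \bar R) :
  measurable_fun setT phi -> 0 <= c -> measurable D -> measurable_fun D f ->
  (forall y, D y -> 0 <= f y)%E ->
  (forall A, measurable A -> A `<=` D -> m2 A = c%:E * m1 (phi @^-1` A))%E ->
  (\int[m2]_(y in D) f y = c%:E * \int[m1]_(x in phi @^-1` D) f (phi x))%E.
Proof.
move=> mphi c0 mD mf f0 m2E.
pose m := image_measure m1 mphi.
have f0' : {in D, forall y, 0 <= f y}%E by move=> p /set_mem/f0.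
have /= <- := ge0_integral_pushforward mphi m1 mD mf f0'.
have /= <- := ge0_integral_mscale m mD (NngNum c0) mf f0.
exact: eq_measure_integral.
Qed.

Section area_integrals.
Context {R : realType}.
Local Notation T := (measurableTypeR R).
Local Notation lam := (@lebesgue_measure R).
Local Notation lam2 := (lam \x lam)%E.

Lemma areaE X : area R X = ((pi^-1)%:E * lam2 X)%E. Proof. by []. Qed.

Lemma scales_area_area (c : R) phi X : scales_area c phi -> measurable X ->
  area R X = (c%:E * area R (phi @^-1` X))%E.
Proof.
by move=> [mphi phiE] mX; rewrite !areaE phiE// muleCA.
Qed.

Lemma ge0_integral_scales_area (c : R) phi D (f : plane R -> \bar R) :
  0 <= c -> scales_area c phi -> measurable D -> measurable_fun D f ->
  (forall p, D p -> 0 <= f p)%E ->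
  (\int[area R]_(p in D) f p =
   c%:E * \int[area R]_(p in phi @^-1` D) f (phi p))%E.
Proof.
move=> c0 sphi mD mf f0.
apply: ge0_integral_image_scale => //; first exact: sphi.1.
by move=> A mA _; exact: scales_area_area.
Qed.

(** The squared distance to the origin. *)
Definition sqn (p : plane R) : R := p.1 ^+ 2 + p.2 ^+ 2.

Lemma sqn_ge0 p : 0 <= sqn p. Proof. by rewrite addr_ge0// sqr_ge0. Qed.

Lemma measurable_sqn : measurable_fun setT (sqn : plane R -> T).
Proof. by apply: measurable_funD => //; exact: measurable_funX. Qed.

Lemma normc_to_complex p : cmod (to_complex p) = Num.sqrt (sqn p).
Proof. by []. Qed.

Lemma sqr_normc_to_complex p : cmod (to_complex p) ^+ 2 = sqn p.
Proof. by rewrite normc_to_complex sqr_sqrtr// sqn_ge0. Qed.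

Lemma lt_normc_sqn (r : R) p : 0 <= r ->
  (cmod (to_complex p) < r) = (sqn p < r ^+ 2).
Proof.
move=> r0; rewrite normc_to_complex -{2}(sqr_sqrtr (sqn_ge0 p)).
by rewrite ltr_pXn2r// nnegrE sqrtr_ge0.
Qed.

Lemma disk_sqn (r : R) : 0 <= r -> disk r = sqn @^-1` `[0, r ^+ 2[.
Proof.
move=> r0; apply/funext => p; apply/propext; rewrite /disk /mkset lt_normc_sqn//.
by rewrite /preimage /mkset /= in_itv/= sqn_ge0.
Qed.

Lemma measurable_sqn_preimage (A : set T) : measurable A -> measurable (sqn @^-1` A).
Proof. by move=> mA; rewrite -[X in measurable X]setTI; exact: measurable_sqn. Qed.

Lemma measurable_disk (r : R) : 0 <= r -> measurable (disk r).
Proof. by move=> r0; rewrite disk_sqn//; exact: measurable_sqn_preimage. Qed.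

(* The normalized area of the unit disk. By homogeneity the image of area under
   [sqn] is [c1] times Lebesgue measure on the half-line; [c1 = 1] then follows
   by integrating [exp (- sqn)], a product of two Gaussians. *)
Let c1 := area R (sqn @^-1` `]-oo, 1[).

Let c1_ge0 : (0 <= c1)%E. Proof. exact: measure_ge0. Qed.

Let c1_fin : c1 \is a fin_num.
Proof.
rewrite ge0_fin_numE; last exact: c1_ge0.
apply: (@le_lt_trans _ _ (area R (`[-1, 1] `*` `[-1, 1]))).
  rewrite le_measure ?inE//.
  - exact: measurable_sqn_preimage.
  - by apply: measurableX; exact: measurable_itv.
  - move=> [x y]; rewrite /sqn/= in_itv/= => xy1.
    split => /=; rewrite in_itv/= -ler_norml -(ler_sqr) ?nnegrE ?normr_ge0 ?ler01//
       expr1n real_normK ?num_real// (le_trans _ (ltW xy1))//.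
    + by rewrite lerDl sqr_ge0.
    + by rewrite lerDr sqr_ge0.
rewrite areaE product_measure1E//=.
by rewrite !lebesgue_measure_itv/= lte_fin -!EFinD; case: ifP => _; rewrite ?mule0 -?EFinM ltry.
Qed.

Let area_sqn_lt (t : R) : 0 < t -> area R (sqn @^-1` `]-oo, t[) = (c1 * t%:E)%E.
Proof.
move=> t0; have st0 : 0 < Num.sqrt t by rewrite sqrtr_gt0.
have E : (fun p : plane R => (Num.sqrt t * p.1, Num.sqrt t * p.2)) @^-1`
    (sqn @^-1` `]-oo, t[) = sqn @^-1` `]-oo, 1[.
  apply/seteqP; split => -[x y];
    rewrite /sqn/= !in_itv/= !exprMn (sqr_sqrtr (ltW t0)) -mulrDr;
    by rewrite -ltr_pdivlMl// mulVf ?gt_eqF.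
rewrite (scales_area_area (scales_area_homothety st0)); last exact: measurable_sqn_preimage.
by rewrite E (sqr_sqrtr (ltW t0)) muleC.
Qed.

Let area_sqn_c1 (A : set T) : measurable A -> A `<=` `[0, +oo[ ->
  area R (sqn @^-1` A) = (c1 * lam A)%E.
Proof.
have mD : measurable (`[0, +oo[%classic : set T) by exact: measurable_itv.
pose m2 : {measure set T -> \bar R} := mscale (NngNum (fine_ge0 c1_ge0)) (mrestr lam mD).
have m2E (B : set T) : m2 B = (c1 * lam (B `&` `[0%R, +oo[))%E.
  by rewrite /m2/= /mscale/= fineK.
suff H (B : set T) : measurable B -> image_measure (area R) measurable_sqn B = m2 B.
  move=> mA A0; transitivity (m2 A); first exact: H.
  by rewrite m2E setIidl.
have HI (t : R) : image_measure (area R) measurable_sqn `]-oo, t[%classic = m2 `]-oo, t[%classic.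
  transitivity (area R (sqn @^-1` `]-oo, t[)) => //.
  rewrite m2E.
  have [t0|t0] := leP t 0.
    rewrite (_ : _ @^-1` _ = set0); last first.
      apply/seteqP; split => p //=; rewrite in_itv/= => /lt_le_trans/(_ t0).
      by rewrite ltNge sqn_ge0.
    rewrite measure0 (_ : _ `&` _ = set0) ?measure0 ?mule0//.
    apply/seteqP; split => x //=; rewrite !in_itv/= andbT => -[/lt_le_trans/(_ t0)].
    by rewrite ltNge => /negP.
  rewrite area_sqn_lt// (_ : _ `&` _ = `[0, t[%classic); last first.
    by apply/seteqP; split => x /=; rewrite !in_itv/= andbT;
      [move=> [-> ->]|move=> /andP[]].
  by rewrite lebesgue_measure_itv/= lte_fin t0 oppr0 adde0.
move=> mB; apply: (@measure_unique _ R T (@RGenInftyO.G R) (fun n => `]-oo, n%:R[%classic) _ _ _ _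
  (image_measure (area R) measurable_sqn) m2) => //.
- exact: RGenInftyO.measurableE.
- move=> _ _ [x ->] [y ->]; exists (Num.min x y).
  by apply/seteqP; split => z /=; rewrite !in_itv/= lt_min; [move=> [-> ->]|move=> /andP].
- by move=> n; exists n%:R.
- apply/seteqP; split => x // _; exists (Num.truncn `|x|).+1 => //=.
  by rewrite in_itv/= (le_lt_trans (ler_norm x))// truncnS_gt.
- by move=> _ [x ->].
- move=> n; rewrite HI m2E ltey_eq fin_numM// ge0_fin_numE//.
  apply: (@le_lt_trans _ _ (lam `[0, n%:R])).
    rewrite le_measure ?inE//; first exact: measurableI.
    by move=> z /=; rewrite !in_itv/= andbT => -[/ltW -> ->].
  by rewrite lebesgue_measure_itv/=; case: ifP => _; rewrite ?ltry.
Qed.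

Let ge0_integral_radial_c1 (D : set T) (f : T -> \bar R) :
  measurable D -> D `<=` `[0, +oo[ -> measurable_fun D f -> (forall t, D t -> 0 <= f t)%E ->
  (\int[area R]_(p in sqn @^-1` D) f (sqn p) = c1 * \int[lam]_(t in D) f t)%E.
Proof.
move=> mD D0 mf f0.
have f0' : {in D, forall y, 0 <= f y}%E by move=> p /set_mem/f0.
have <- := ge0_integral_pushforward measurable_sqn (area R) mD mf f0'.
rewrite -(fineK c1_fin).
have c0 : 0 <= fine c1 by rewrite fine_ge0.
apply: (@ge0_integral_image_scale _ _ _ _ R lam (image_measure (area R) measurable_sqn) id) => //.
by move=> A mA AD; rewrite fineK// -area_sqn_c1//; exact: subset_trans D0.
Qed.

Let c1E : c1 = 1%E.
Proof.
have mexp : measurable_fun setT (fun t : T => expR (- t)).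
  by apply: measurableT_comp => //; exact: measurable_funN.
have intexp : (\int[lam]_(t in `[0%R, +oo[) (expR (- t))%:E = 1)%E.
  rewrite -(integral_exponential_pdf (@ltr01 R)) [LHS]integral_mkcond.
  apply: eq_integral => t _; rewrite /exponential_pdf !patchE.
  by case: ifP => // _; rewrite mul1r mulN1r.
have := @ge0_integral_radial_c1 `[0%R, +oo[%classic (fun t => (expR (- t))%:E).
rewrite intexp mule1 => <- //; last first.
  by apply: measurable_funTS; apply/measurable_EFinP.
rewrite (_ : _ @^-1` _ = setT); last first.
  by apply/seteqP; split => p //= _; rewrite in_itv/= sqn_ge0.
have mg : measurable_fun setT (fun p : plane R => (expR (- sqn p))%:E).
  by apply/measurable_EFinP; exact: (measurableT_comp mexp measurable_sqn).
have g0 (p : plane R) : (0 <= (expR (- sqn p))%:E)%E by rewrite lee_fin expR_ge0.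
rewrite /area.
rewrite (ge0_integral_mscale (lam2 : {measure set _ -> \bar R}) measurableT
  (NngNum (pi_inv_ge0 R)) mg)//.
rewrite fubini_tonelli1//= /fubini_F/=.
have gaussE x : (\int[lam]_y (expR (- sqn (x, y)))%:E = (gauss_fun x)%:E * (Num.sqrt pi)%:E)%E.
  rewrite -(@integralT_gauss R) -ge0_integralZl//=.
  - by apply: eq_integral => y _; rewrite /gauss_fun -EFinM -expRD -opprD.
  - by apply/measurable_EFinP; exact: measurable_gauss_fun.
  - by move=> y _; rewrite lee_fin gauss_fun_ge0.
  - by rewrite lee_fin gauss_fun_ge0.
under eq_integral do rewrite gaussE.
rewrite ge0_integralZr//=.
- rewrite integralT_gauss -!EFinM -expr2 sqr_sqrtr ?pi_ge0//.
  by rewrite mulVf// gt_eqF// pi_gt0.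
- by apply/measurable_EFinP; exact: measurable_gauss_fun.
- by move=> y _; rewrite lee_fin gauss_fun_ge0.
Qed.

(** Polar integration of radial functions: the image of normalized area under the
    squared modulus is Lebesgue measure on the half-line. *)
Lemma ge0_integral_radial (D : set T) (f : T -> \bar R) :
  measurable D -> D `<=` `[0, +oo[ -> measurable_fun D f ->
  (forall t, D t -> 0 <= f t)%E ->
  (\int[area R]_(p in sqn @^-1` D) f (sqn p) = \int[lam]_(t in D) f t)%E.
Proof. by move=> *; rewrite ge0_integral_radial_c1// c1E mul1e. Qed.

Lemma area_disk (r : R) : 0 <= r -> area R (disk r) = (r ^+ 2)%:E.
Proof.
move=> r0; rewrite disk_sqn// area_sqn_c1//.
- rewrite c1E mul1e lebesgue_measure_itv/= lte_fin oppr0 adde0.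
  by case: ifPn => //; rewrite -leNgt => r20; congr EFin; apply/eqP; rewrite eq_le r20 sqr_ge0.
- by move=> x /=; rewrite !in_itv/= andbT => /andP[].
Qed.

End area_integrals.

(** * Real and imaginary parts *)

Section complex_parts.
Context {R : realType}.
Implicit Types x y : R[i].

Lemma complexReD x y : complex.Re (x + y) = complex.Re x + complex.Re y.
Proof. by case: x; case: y. Qed.

Lemma complexImD x y : complex.Im (x + y) = complex.Im x + complex.Im y.
Proof. by case: x; case: y. Qed.

Lemma complexReM x y : complex.Re (x * y) =
  complex.Re x * complex.Re y - complex.Im x * complex.Im y.
Proof. by case: x; case: y. Qed.

Lemma complexImM x y : complex.Im (x * y) =
  complex.Re x * complex.Im y + complex.Im x * complex.Re y.
Proof. by case: x => a b; case: y => c d /=; rewrite [b * c]mulrC. Qed.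

Lemma complexRe_sum I (s : seq I) (P : pred I) (F : I -> R[i]) :
  complex.Re (\sum_(i <- s | P i) F i) = \sum_(i <- s | P i) complex.Re (F i).
Proof. exact: (big_morph _ complexReD erefl). Qed.

Lemma complexIm_sum I (s : seq I) (P : pred I) (F : I -> R[i]) :
  complex.Im (\sum_(i <- s | P i) F i) = \sum_(i <- s | P i) complex.Im (F i).
Proof. exact: (big_morph _ complexImD erefl). Qed.

Lemma complexRe_conj x : complex.Re x^* = complex.Re x. Proof. by case: x. Qed.

Lemma complexIm_conj x : complex.Im x^* = - complex.Im x. Proof. by case: x. Qed.

Lemma conjcM x y : (x * y)^* = x^* * y^*.
Proof. exact: (rmorphM (@conjc R)). Qed.

Lemma conjcX x n : (x ^+ n)^* = x^* ^+ n.
Proof. exact: (rmorphXn (@conjc R)). Qed.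

Lemma conjc_sum I (s : seq I) (P : pred I) (F : I -> R[i]) :
  (\sum_(i <- s | P i) F i)^* = \sum_(i <- s | P i) (F i)^*.
Proof. exact: (big_morph _ (rmorphD (@conjc R)) (rmorph0 (@conjc R))). Qed.

Lemma conjc_natr n : (n%:R : R[i])^* = n%:R.
Proof. exact: (rmorph_nat (@conjc R)). Qed.

Lemma conjc_re (a : R) : (a%:C)^* = a%:C.
Proof. by rewrite /= oppr0. Qed.

Lemma complex_ext x y :
  complex.Re x = complex.Re y -> complex.Im x = complex.Im y -> x = y.
Proof. by case: x => a b; case: y => c d /= -> ->. Qed.

Lemma sqr_normc_parts x : cmod x ^+ 2 = complex.Re x ^+ 2 + complex.Im x ^+ 2.
Proof. by case: x => a b; rewrite /= sqr_sqrtr// addr_ge0// sqr_ge0. Qed.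

Lemma normc_ge0 x : 0 <= cmod x. Proof. by case: x => a b; exact: sqrtr_ge0. Qed.

Lemma sqr_normcE x : cmod x ^+ 2 = complex.Re (x * x^*).
Proof.
by rewrite sqr_normc_parts complexReM complexRe_conj complexIm_conj mulrN opprK !expr2.
Qed.

Lemma normc_conj x : cmod x^* = cmod x.
Proof. by case: x => a b /=; rewrite sqrrN. Qed.

Lemma normcX x n : cmod (x ^+ n) = cmod x ^+ n.
Proof.
elim: n => [|n IH]; first by rewrite !expr0 ComplexField.Normc.normc1.
by rewrite !exprS ComplexField.Normc.normcM IH.
Qed.

Lemma normc_real (a : R) : cmod (a%:C) = `|a|.
Proof. by rewrite /= expr0n addr0 sqrtr_sqr. Qed.

Lemma normr_Re_le x : `|complex.Re x| <= cmod x.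
Proof.
rewrite -ler_sqr ?nnegrE ?normc_ge0// sqr_normc_parts real_normK ?num_real//.
by rewrite lerDl sqr_ge0.
Qed.

Lemma normr_Im_le x : `|complex.Im x| <= cmod x.
Proof.
rewrite -ler_sqr ?nnegrE ?normc_ge0// sqr_normc_parts real_normK ?num_real//.
by rewrite lerDr sqr_ge0.
Qed.

End complex_parts.

(** Measurability of a complex-valued function, through its two real parts. *)
Definition cmeasurable_fun d (T : measurableType d) (R : realType) (D : set T)
    (F : T -> R[i]) :=
  measurable_fun D (fun p => complex.Re (F p)) /\
  measurable_fun D (fun p => complex.Im (F p)).

Section cmeasurable.
Context d (T : measurableType d) {R : realType}.
Implicit Types (D : set T) (F G : T -> R[i]).

Lemma cmeasurable_cst D (c : R[i]) : cmeasurable_fun D (fun=> c).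
Proof. by split; exact: measurable_cst. Qed.

Lemma cmeasurable_funD D F G : cmeasurable_fun D F -> cmeasurable_fun D G ->
  cmeasurable_fun D (fun p => F p + G p).
Proof.
move=> [F1 F2] [G1 G2]; split.
  by under eq_fun do rewrite complexReD; exact: measurable_funD.
by under eq_fun do rewrite complexImD; exact: measurable_funD.
Qed.

Lemma cmeasurable_funM D F G : cmeasurable_fun D F -> cmeasurable_fun D G ->
  cmeasurable_fun D (fun p => F p * G p).
Proof.
move=> [F1 F2] [G1 G2]; split.
  under eq_fun do rewrite complexReM.
  by apply: measurable_funB; exact: measurable_funM.
under eq_fun do rewrite complexImM.
by apply: measurable_funD; exact: measurable_funM.
Qed.

Lemma cmeasurable_fun_conj D F : cmeasurable_fun D F ->
  cmeasurable_fun D (fun p => (F p)^*).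
Proof.
move=> [F1 F2]; split.
  by under eq_fun do rewrite complexRe_conj.
by under eq_fun do rewrite complexIm_conj; exact: measurable_funN.
Qed.

Lemma cmeasurable_funX D F n : cmeasurable_fun D F ->
  cmeasurable_fun D (fun p => F p ^+ n).
Proof.
move=> mF; elim: n => [|n IH]; first exact: cmeasurable_cst.
by under eq_fun do rewrite exprS; exact: cmeasurable_funM.
Qed.

Lemma cmeasurable_fun_sum D N (F : nat -> T -> R[i]) :
  (forall n, cmeasurable_fun D (F n)) ->
  cmeasurable_fun D (fun p => \sum_(n < N) F n p).
Proof.
move=> mF; elim: N => [|N IH].
  by under eq_fun do rewrite big_ord0; exact: cmeasurable_cst.
by under eq_fun do rewrite big_ord_recr/=; exact: cmeasurable_funD.
Qed.

Lemma measurable_fun_normc D F : cmeasurable_fun D F ->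
  measurable_fun D (fun p => cmod (F p)).
Proof.
move=> [F1 F2].
rewrite (_ : (fun p => _) = (fun p =>
    Num.sqrt (complex.Re (F p) ^+ 2 + complex.Im (F p) ^+ 2))).
  apply: (@measurableT_comp _ _ _ _ _ _ (@Num.sqrt R)).
    by apply: continuous_measurable_fun; exact: sqrt_continuous.
  by apply: measurable_funD; exact: measurable_funX.
by apply/funext => p; case: (F p).
Qed.

End cmeasurable.

(** * Parseval's identity on the circle *)

Section integration_tools.
Context {R : realType}.
Local Notation T := (measurableTypeR R).
Local Notation lam := (@lebesgue_measure R).

(** A form of the fundamental theorem of calculus. *)
Lemma integral_is_derive (f F : R -> R) (a b : R) : a < b ->
  (forall x, x \in `[a, b] -> is_derive x 1 F (f x)) ->
  (forall x, x \in `[a, b] -> {for x, continuous f}) ->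
  (\int[lam]_(x in `[a, b]) (f x)%:E = (F b - F a)%:E)%E.
Proof.
move=> ab dF cf.
have cF x : x \in `[a, b] -> {for x, continuous F}.
  move=> xab; apply: differentiable_continuous; apply/derivable1_diffP.
  by have := dF x xab => -[].
rewrite (@continuous_FTC2 _ f F)//.
- by apply: continuous_in_subspaceT => x /set_mem; exact: cf.
- split.
  + by move=> x xab; have := dF x (subset_itv_oo_cc xab) => -[].
  + by apply: cvg_at_right_filter; apply: cF; rewrite in_itv/= lexx ltW.
  + by apply: cvg_at_left_filter; apply: cF; rewrite in_itv/= lexx ltW.
- move=> x xab; rewrite derive1E.
  by have := dF x (subset_itv_oo_cc xab) => -[].
Qed.

Lemma Rintegral_sum d (X : measurableType d) (m : {measure set X -> \bar R})
    (D : set X) N (f : nat -> X -> R) : measurable D ->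
  (forall n, m.-integrable D (EFin \o f n)) ->
  m.-integrable D (EFin \o (fun x => \sum_(n < N) f n x)) /\
  (\int[m]_(x in D) (\sum_(n < N) f n x) = \sum_(n < N) \int[m]_(x in D) f n x)%R.
Proof.
move=> mD mf; elim: N => [|N [iN EN]].
  split; last first.
    by rewrite big_ord0; under eq_Rintegral do rewrite big_ord0; rewrite Rintegral_cst// mul0r.
  rewrite (_ : _ \o _ = cst 0%E); first exact: integrable0.
  by apply/funext => x /=; rewrite big_ord0.
split.
  rewrite (_ : _ \o _ = (EFin \o (fun x => \sum_(n < N) f n x)) \+ (EFin \o f N)).
    exact: integrableD.
  by apply/funext => x /=; rewrite big_ord_recr.
rewrite big_ord_recr/= -EN -RintegralD//.
by apply: eq_Rintegral => x _; rewrite big_ord_recr.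
Qed.

End integration_tools.

Section circle.
Context {R : realType}.
Local Notation T := (measurableTypeR R).
Local Notation lam := (@lebesgue_measure R).

(** The point of argument [t] on the unit circle. *)
Definition expi (t : R) : R[i] := cos t +i* sin t.

Lemma expiX (t : R) n : expi t ^+ n = expi (n%:R * t).
Proof.
elim: n => [|n IH]; first by rewrite expr0 mul0r /expi cos0 sin0.
rewrite exprS IH /expi -natr1 mulrDl mul1r cosD sinD; simpc.
by congr (_ +i* _); ring.
Qed.

Lemma normc_expi (t : R) : cmod (expi t) = 1.
Proof. by rewrite /= cos2Dsin2 sqrtr1. Qed.

Lemma expiX_conj (t : R) m n :
  expi t ^+ m * (expi t ^+ n)^* = expi ((m%:R - n%:R) * t).
Proof.
rewrite !expiX /expi mulrBl cosB sinB; simpc.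
by congr (_ +i* _); ring.
Qed.

Lemma expi_2pi_nat (m n : nat) : expi ((m%:R - n%:R) * (2 * pi)) = 1 :> R[i].
Proof.
have E k : expi (k%:R * (2 * pi)) = 1 :> R[i].
  rewrite -expiX /expi; have -> : 2 * pi = pi *+ 2 :> R by rewrite mulr2n; ring.
  by rewrite cos2pi sin2pi expr1n.
have := expiX_conj (2 * pi : R) m n; rewrite !expiX !E => <-.
by rewrite (conjc_natr 1) mulr1.
Qed.

Lemma measurable_expi : cmeasurable_fun setT (expi : T -> R[i]).
Proof.
split; apply: continuous_measurable_fun; [exact: continuous_cos|exact: continuous_sin].
Qed.

Lemma continuous_cosM (k : R) : continuous (fun t => cos (k * t)).
Proof.
move=> t; apply: continuous_comp; last exact: continuous_cos.
by apply: continuousM; [exact: cst_continuous|exact: id].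
Qed.

Lemma continuous_sinM (k : R) : continuous (fun t => sin (k * t)).
Proof.
move=> t; apply: continuous_comp; last exact: continuous_sin.
by apply: continuousM; [exact: cst_continuous|exact: id].
Qed.

Let circ : set T := `[0%R, 2 * pi : R]%classic.

Let pi2_gt0 : 0 < 2 * pi :> R. Proof. by rewrite mulr_gt0// pi_gt0. Qed.

Let integrable_circ (f : R -> R) : continuous f -> lam.-integrable circ (EFin \o f).
Proof.
move=> cf; apply: continuous_compact_integrable; first exact: segment_compact.
exact: continuous_subspaceT.
Qed.

Let continuous_trig (c : R[i]) m n :
  continuous (fun t => complex.Re (c * (expi t ^+ m * (expi t ^+ n)^*))).
Proof.
have -> : (fun t => complex.Re (c * (expi t ^+ m * (expi t ^+ n)^*))) =
   (fun t => complex.Re c * cos ((m%:R - n%:R) * t) - complex.Im c * sin ((m%:R - n%:R) * t)).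
  by apply/funext => t; rewrite expiX_conj complexReM.
move=> t.
have c1 : {for t, continuous (fun t : R => complex.Re c * cos ((m%:R - n%:R) * t))}.
  by apply: continuousM; [exact: cst_continuous|exact: continuous_cosM].
have c2 : {for t, continuous (fun t : R => complex.Im c * sin ((m%:R - n%:R) * t))}.
  by apply: continuousM; [exact: cst_continuous|exact: continuous_sinM].
exact: (@continuousB R R^o _ _ _ _ c1 c2).
Qed.

Lemma Rintegral_circle_monomials (c : R[i]) m n :
  (\int[lam]_(t in `[0, (2 * pi : R)%R]) complex.Re (c * (expi t ^+ m * (expi t ^+ n)^*))
   = if m == n then 2 * pi * complex.Re c else 0)%R.
Proof.
have [->|mn] := eqVneq m n.
  under eq_Rintegral do rewrite expiX_conj subrr mul0r /expi cos0 sin0 mulr1.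
  have lcirc : lam circ = (2 * pi)%:E.
    by rewrite lebesgue_measure_itv/= lte_fin pi2_gt0/= oppr0 adde0.
  rewrite Rintegral_cst//; transitivity (complex.Re c * fine (lam circ)) => //.
  by rewrite lcirc mulrC.
pose k : R := m%:R - n%:R.
have k0 : k != 0 by rewrite subr_eq0 eqr_nat.
pose F t := (complex.Re c * sin (k * t) + complex.Im c * cos (k * t)) / k.
have dF (t : R) : is_derive t 1 F (complex.Re (c * (expi t ^+ m * (expi t ^+ n)^*))).
  rewrite expiX_conj -/k complexReM /expi/=.
  rewrite /F; apply: is_derive_eq.
  by rewrite /= !scaler0 !add0r; rewrite /GRing.scale/=; field.
have := integral_is_derive pi2_gt0 (fun t _ => dF t)
  (fun t _ => @continuous_trig c m n t).
rewrite /Rintegral => -> /=.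
have := expi_2pi_nat m n; rewrite /expi -/k => -[E1 E2].
by rewrite /F E1 E2 !mulr0 sin0 cos0 mulr0 subrr.
Qed.

(** Parseval's identity for polynomials in [expi t]. *)
Lemma integral_circle_sum (c : nat -> R[i]) N :
  (\int[lam]_(t in `[0%R, (2 * pi : R)%R]) (cmod (\sum_(n < N) c n * expi t ^+ n) ^+ 2)%:E
   = (2 * pi * \sum_(n < N) cmod (c n) ^+ 2)%:E)%E.
Proof.
pose f (m n : nat) (t : R) : R := complex.Re (c m * (c n)^* * (expi t ^+ m * (expi t ^+ n)^*)).
have fE t : cmod (\sum_(n < N) c n * expi t ^+ n) ^+ 2 =
    \sum_(m < N) \sum_(n < N) f m n t.
  rewrite sqr_normcE conjc_sum mulr_suml complexRe_sum.
  apply: eq_bigr => m _; rewrite mulr_sumr complexRe_sum.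
  by apply: eq_bigr => n _; rewrite /f conjcM mulrACA.
have mc : measurable circ by exact: measurable_itv.
have intf m n : lam.-integrable circ (EFin \o f m n).
  by apply: integrable_circ; exact: continuous_trig.
have int1 m := (Rintegral_sum N mc (intf m)).
have int2 := Rintegral_sum N mc (fun m => (int1 m).1).
under eq_integral do rewrite fE.
rewrite -[LHS]fineK; last exact: integrable_fin_num int2.1.
congr EFin; rewrite -[LHS]/(Rintegral _ _ _) int2.2 mulr_sumr.
apply: eq_bigr => m _; rewrite (int1 m).2 (bigD1 m)//= /f.
rewrite Rintegral_circle_monomials eqxx -sqr_normcE big1 ?addr0// => n nm.
rewrite Rintegral_circle_monomials; case: eqP => // /val_inj mn.
by rewrite mn eqxx in nm.
Qed.

End circle.

(** * Parseval's identity for radial weights on the plane *)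

Lemma sigma_finite_area (R : realType) : sigma_finite setT (area R).
Proof.
exists (fun n => disk n%:R).
  apply/seteqP; split => p // _; exists (Num.truncn (cmod (to_complex p))).+1 => //.
  by rewrite /disk /mkset truncnS_gt.
by move=> n; split; [exact: measurable_disk|rewrite area_disk// ltry].
Qed.



(** The set function [area], given a sigma-finite structure for Tonelli's theorem. *)
Definition area_fun (R : realType) : set (plane R) -> \bar R := area R.
Arguments area_fun : clear implicits.
HB.instance Definition _ (R : realType) := Measure.copy (area_fun R) (area R).
HB.instance Definition _ (R : realType) :=
  Measure_isSigmaFinite.Build _ _ _ (area_fun R) (sigma_finite_area R).

Section parseval.
Context {R : realType}.
Local Notation T := (measurableTypeR R).
Local Notation lam := (@lebesgue_measure R).
Local Notation lam2 := (lam \x lam)%E.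

Lemma cmeasurable_to_complex : cmeasurable_fun setT (@to_complex R).
Proof. by split; [exact: measurable_fst|exact: measurable_snd]. Qed.

(** Rotation of the plane by the angle [t]. *)
Definition rotation (t : R) (p : plane R) : plane R :=
  (cos t * p.1 - sin t * p.2, sin t * p.1 + cos t * p.2).

Lemma to_complex_rotation t p : to_complex (rotation t p) = expi t * to_complex p.
Proof. by rewrite /to_complex /rotation /expi; simpc; rewrite [sin t * _ + _]addrC. Qed.

Lemma sqn_rotation t p : sqn (rotation t p) = sqn p.
Proof.
by rewrite -!sqr_normc_to_complex to_complex_rotation ComplexField.Normc.normcM normc_expi mul1r.
Qed.

Lemma cmeasurable_horner_sum (h : nat -> R[i]) N :
  cmeasurable_fun setT (fun p : plane R => \sum_(n < N) h n * to_complex p ^+ n).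
Proof.
apply: (@cmeasurable_fun_sum _ _ _ _ _ (fun n p => h n * to_complex p ^+ n)) => n.
apply: cmeasurable_funM; first exact: cmeasurable_cst.
exact: cmeasurable_funX cmeasurable_to_complex.
Qed.

(** Averaging over rotations replaces [`|h|^2] by its mean on circles, which
    Parseval's identity computes. *)
Lemma ge0_integral_radial_parseval (v : T -> R) (h : nat -> R[i]) N :
  measurable_fun setT v -> (forall t, 0 <= v t) ->
  (\int[area R]_p (v (sqn p) * cmod (\sum_(n < N) h n * to_complex p ^+ n) ^+ 2)%:E =
   \int[lam]_(t in `[0%R, +oo[) (v t * \sum_(n < N) cmod (h n) ^+ 2 * t ^+ n)%:E)%E.
Proof.
move=> mv v0.
pose H z : R[i] := \sum_(n < N) h n * z ^+ n.
have mH : measurable_fun setT (fun p : plane R => cmod (H (to_complex p))).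
  exact: measurable_fun_normc (cmeasurable_horner_sum h N).
have pi2_gt0 : 0 < 2 * pi :> R by rewrite mulr_gt0// pi_gt0.
pose circ : set T := `[0%R, 2 * pi]%classic.
have mcirc : measurable circ by exact: measurable_itv.
have lcirc : lam circ = (2 * pi)%:E.
  by rewrite lebesgue_measure_itv/= lte_fin pi2_gt0/= oppr0 adde0.
pose f (p : plane R) : \bar R := (v (sqn p) * cmod (H (to_complex p)) ^+ 2)%:E.
have f0 p : (0 <= f p)%E by rewrite lee_fin mulr_ge0// sqr_ge0.
have mf : measurable_fun setT f.
  apply/measurable_EFinP; apply: measurable_funM.
    exact: (measurableT_comp mv measurable_sqn).
  exact: measurable_funX.
have rotE t : (\int[area R]_p f p = \int[area R]_p f (rotation t p))%E.
  have srot := scales_area_rotation (cos2Dsin2 t).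
  have := ge0_integral_scales_area ler01 srot measurableT mf (fun p _ => f0 p).
  by rewrite mul1e preimage_setT.
pose g (x : plane R * T) : \bar R :=
  (v (sqn x.1) * cmod (H (expi x.2 * to_complex x.1)) ^+ 2 * \1_circ x.2)%:E.
have g0 x : (0 <= g x)%E.
  by rewrite lee_fin mulr_ge0 ?indicE ?ler0n// mulr_ge0// sqr_ge0.
have mg : measurable_fun setT g.
  have m1 : measurable_fun setT (fun x : plane R * T => x.1) by exact: measurable_fst.
  have m2 : measurable_fun setT (fun x : plane R * T => x.2) by exact: measurable_snd.
  have cm1 : cmeasurable_fun setT (fun x : plane R * T => to_complex x.1).
    have [re im] := cmeasurable_to_complex.
    by split; [exact: (measurableT_comp re m1)|exact: (measurableT_comp im m1)].
  have cm2 : cmeasurable_fun setT (fun x : plane R * T => expi x.2).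
    have [re im] := @measurable_expi R.
    by split; [exact: (measurableT_comp re m2)|exact: (measurableT_comp im m2)].
  apply/measurable_EFinP; apply: measurable_funM; last first.
    by apply: (measurableT_comp _ m2); exact: measurable_indic.
  apply: measurable_funM.
    by apply: (measurableT_comp mv); exact: (measurableT_comp measurable_sqn m1).
  apply: measurable_funX; apply: measurable_fun_normc.
  apply: (@cmeasurable_fun_sum _ _ _ _ _
    (fun n (x : plane R * T) => h n * (expi x.2 * to_complex x.1) ^+ n)) => n.
  apply: cmeasurable_funM; first exact: cmeasurable_cst.
  by apply: cmeasurable_funX; exact: cmeasurable_funM.
pose s (p : plane R) : R := v (sqn p) * \sum_(n < N) cmod (h n) ^+ 2 * sqn p ^+ n.
have gE p : (\int[lam]_t g (p, t) = ((2 * pi) * s p)%:E)%E.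
  transitivity (\int[lam]_(t in circ)
      ((v (sqn p))%:E * (cmod (\sum_(n < N) h n * to_complex p ^+ n * expi t ^+ n) ^+ 2)%:E))%E.
    rewrite [RHS]integral_mkcond; apply: eq_integral => t _.
    rewrite /g/= patchE indicE; case: ifPn => tc; last by rewrite mulr0.
    rewrite mulr1 -EFinM /H; congr (_ * cmod _ ^+ 2)%:E.
    by apply: eq_bigr => n _; rewrite exprMn mulrCA mulrC mulrAC.
  rewrite ge0_integralZl//=.
  - rewrite (integral_circle_sum (fun n => h n * to_complex p ^+ n)) -EFinM mulrCA.
    congr (_ * (_ * _))%:E; apply: eq_bigr => n _.
    by rewrite ComplexField.Normc.normcM exprMn normcX -exprM mulnC exprM sqr_normc_to_complex.
  - apply/measurable_EFinP/measurable_funTS/measurable_funX/measurable_fun_normc.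
    apply: (@cmeasurable_fun_sum _ _ _ _ _ (fun n t => h n * to_complex p ^+ n * expi t ^+ n)) => n.
    apply: cmeasurable_funM; first exact: cmeasurable_cst.
    exact: cmeasurable_funX (@measurable_expi R).
  - by move=> t _; rewrite lee_fin sqr_ge0.
  - by rewrite lee_fin.
have s0 p : 0 <= s p.
  rewrite mulr_ge0// sumr_ge0// => n _.
  by rewrite mulr_ge0 ?sqr_ge0// exprn_ge0// sqn_ge0.
have ms0 : measurable_fun setT (fun t : T => v t * \sum_(n < N) cmod (h n) ^+ 2 * t ^+ n).
  apply: measurable_funM => //; apply: measurable_sum => n.
  by apply: measurable_funM => //; exact: measurable_funX.
have ms : measurable_fun setT s := measurableT_comp ms0 measurable_sqn.
pose ar : {sigma_finite_measure set (plane R) -> \bar R} := area_fun R.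
have Jx : (\int[area R]_p f p * (2 * pi)%:E = (2 * pi)%:E * \int[area R]_p (s p)%:E)%E.
  transitivity (\int[lam]_t \int[ar]_p g (p, t))%E.
    rewrite -lcirc -(integral_cst _ mcirc) integral_mkcond; apply: eq_integral => t _.
    rewrite patchE; case: ifPn => tc.
      rewrite (rotE t); apply: eq_integral => p _.
      by rewrite /f /g/= indicE tc mulr1 sqn_rotation to_complex_rotation.
    by rewrite integral0_eq// => p _; rewrite /g/= indicE (negPf tc) mulr0.
  rewrite -(fubini_tonelli (m1 := ar) (m2 := lam) g mg g0).
  under eq_integral do rewrite gE EFinM.
  rewrite ge0_integralZl//=.
  - exact/measurable_EFinP.
  - by move=> p _; rewrite lee_fin.
  - by rewrite lee_fin ltW.
have -> : (\int[area R]_p f p = \int[area R]_p (s p)%:E)%E.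
  have : ((2 * pi)^-1%:E * (\int[area R]_p f p * (2 * pi)%:E) =
          (2 * pi)^-1%:E * ((2 * pi)%:E * \int[area R]_p (s p)%:E))%E by rewrite Jx.
  by rewrite [X in (_ * X)%E = _]muleC !muleA -EFinM mulVf ?gt_eqF// !mul1e.
have := @ge0_integral_radial R `[0%R, +oo[%classic
  (fun t => (v t * \sum_(n < N) cmod (h n) ^+ 2 * t ^+ n)%:E).
rewrite (_ : _ @^-1` _ = setT); last first.
  by apply/seteqP; split => p //= _; rewrite in_itv/= sqn_ge0.
apply => //.
  by apply: measurable_funTS; exact/measurable_EFinP.
move=> t /=; rewrite in_itv/= andbT => t0.
rewrite lee_fin mulr_ge0// sumr_ge0// => n _.
by rewrite mulr_ge0 ?sqr_ge0// exprn_ge0.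
Qed.

End parseval.

(** * Weighted square norms on disks *)

Section disk_integrals.
Context {R : realType}.
Local Notation T := (measurableTypeR R).
Local Notation lam := (@lebesgue_measure R).

Lemma integral_disk_patch (r : R) (f : plane R -> R) : 0 <= r ->
  (\int[area R]_(p in disk r) (f p)%:E =
   \int[area R]_p (\1_(`[0%R, r ^+ 2[%classic : set T) (sqn p) * f p)%:E)%E.
Proof.
move=> r0; rewrite integral_mkcond; apply: eq_integral => p _.
rewrite patchE indicE disk_sqn//.
rewrite (_ : (p \in _) = (sqn p \in (`[0%R, r ^+ 2[%classic : set T))); last first.
  by apply/idP/idP; rewrite !inE.
by case: ifPn => _; rewrite ?mul1r ?mul0r.
Qed.

Lemma integral_horner_deriv (Q : {poly R}) (b : R) : 0 < b ->
  (\int[lam]_(t in `[0%R, b[) (Q^`().[t])%:E = (Q.[b] - Q.[0])%:E)%E.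
Proof.
move=> b0.
have dQ (t : R) : is_derive t 1 (horner Q) Q^`().[t].
  by apply: DeriveDef; [exact: derivable_horner|rewrite derivE derive1E].
rewrite integral_itv_bndo_bndc; last first.
  apply/measurable_EFinP/measurable_funTS; apply: continuous_measurable_fun.
  exact: continuous_horner.
apply: integral_is_derive => // t _; exact: continuous_horner.
Qed.

(** The weighted square norm of a polynomial on a disk. *)
Lemma integral_disk_weighted (r : R) (h : nat -> R[i]) N : 0 < r < 1 ->
  (\int[area R]_(p in disk r) ((1 - cmod (to_complex p) ^+ 2) *
      cmod (\sum_(n < N) h n * to_complex p ^+ n) ^+ 2)%:E =
   (\sum_(n < N) cmod (h n) ^+ 2 *
     ((r ^+ 2) ^+ n.+1 / n.+1%:R - (r ^+ 2) ^+ n.+2 / n.+2%:R))%:E)%E.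
Proof.
move=> /andP[r0 r1]; have r21 : r ^+ 2 < 1 by rewrite expr_lt1// ltW.
have r20 : 0 < r ^+ 2 by rewrite exprn_gt0.
rewrite integral_disk_patch ?ltW//.
pose v (t : T) : R := \1_(`[0%R, r ^+ 2[%classic : set T) t * (1 - t).
have mI : measurable (`[0, r ^+ 2[%classic : set T) by exact: measurable_itv.
transitivity (\int[area R]_p (v (sqn p) *
    cmod (\sum_(n < N) h n * to_complex p ^+ n) ^+ 2)%:E)%E.
  by apply: eq_integral => p _; rewrite mulrA sqr_normc_to_complex.
rewrite ge0_integral_radial_parseval; first last.
- move=> t; rewrite /v indicE; case: (boolP (_ \in _)) => [|_]; last by rewrite mul0r.
  rewrite inE/= in_itv/= => /andP[_ t1].
  by rewrite mul1r subr_ge0 ltW// (lt_trans t1).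
- by apply: measurable_funM; [exact: measurable_indic|exact: measurable_funB].
pose c (n : nat) : R := cmod (h n) ^+ 2.
pose Q : {poly R} := \sum_(n < N) c n *: (n.+1%:R^-1 *: 'X^(n.+1) - n.+2%:R^-1 *: 'X^(n.+2)).
have Qx x : Q.[x] = \sum_(n < N) c n * (x ^+ n.+1 / n.+1%:R - x ^+ n.+2 / n.+2%:R).
  rewrite /Q horner_sum; apply: eq_bigr => n _.
  by rewrite hornerZ hornerD hornerN !hornerZ !hornerXn ![_^-1 * _]mulrC.
have Q'x x : Q^`().[x] = (1 - x) * \sum_(n < N) c n * x ^+ n.
  rewrite /Q raddf_sum horner_sum mulr_sumr; apply: eq_bigr => n _ /=.
  rewrite derivZ derivB !derivZ !derivXn hornerZ hornerD hornerN !hornerZ.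
  rewrite !hornerMn !hornerXn/= -(mulr_natr (x ^+ n)) -(mulr_natr (x ^+ n.+1)).
  by rewrite ![_^-1 * (_ * _)]mulrCA !mulVf ?pnatr_eq0// !mulr1 exprS; ring.
transitivity (\int[lam]_(t in `[0%R, (r ^+ 2)%R[) (Q^`().[t])%:E)%E.
  rewrite [LHS]integral_mkcond [RHS]integral_mkcond; apply: eq_integral => t _.
  rewrite !patchE !mem_setE !in_itv/= andbT /v indicE mem_setE in_itv/=.
  by case: (0 <= t) => //=; case: ifPn => _; rewrite ?mul0r// mul1r Q'x.
rewrite integral_horner_deriv// !Qx [X in _ - X]big1 ?subr0// => n _.
by rewrite !expr0n !mul0r subrr mulr0.
Qed.

Lemma integral_disk_hyperbolic (r : R) : 0 < r < 1 ->
  (\int[area R]_(p in disk r) ((1 - cmod (to_complex p) ^+ 2)^-1)%:E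
   = (log_weight r)%:E)%E.
Proof.
move=> /andP[r0 r1]; have r21 : r ^+ 2 < 1 by rewrite expr_lt1// ltW.
have r20 : 0 < r ^+ 2 by rewrite exprn_gt0.
rewrite disk_sqn ?ltW//.
pose f (t : T) : \bar R := ((1 - t)^-1)%:E.
under eq_integral do rewrite sqr_normc_to_complex.
have cf (t : R) : t \in `[0, r ^+ 2] -> {for t, continuous (fun t : R => (1 - t)^-1)}.
  rewrite in_itv/= => /andP[_ t1].
  have t10 : 1 - t != 0 by rewrite subr_eq0 gt_eqF// (le_lt_trans t1).
  apply: continuousV => //.
  by apply: (@continuousB R R^o); [exact: cst_continuous|exact: id].
have mf : measurable_fun (`[0, r ^+ 2[%classic : set T) (fun t : R => (1 - t)^-1).
  apply: (@measurable_funS _ _ _ _ (`[0, r ^+ 2]%classic : set T)) => //.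
    by move=> t /=; rewrite !in_itv/= => /andP[-> /ltW].
  apply: subspace_continuous_measurable_fun => //.
  by apply: continuous_in_subspaceT => t /set_mem; exact: cf.
rewrite (@ge0_integral_radial R _ f)//; first last.
- move=> t /=; rewrite in_itv/= => /andP[_ t1].
  by rewrite lee_fin invr_ge0 subr_ge0 ltW// (lt_trans t1).
- exact/measurable_EFinP.
- by move=> x /=; rewrite !in_itv/= andbT => /andP[].
rewrite /f integral_itv_bndo_bndc; last exact/measurable_EFinP.
have dF (t : R) : t \in `[0, r ^+ 2] ->
    is_derive t 1 (fun t : R => - ln (1 - t)) (1 - t)^-1.
  rewrite in_itv/= => /andP[_ t1].
  have t10 : 0 < 1 - t by rewrite subr_gt0 (le_lt_trans t1).
  have d1 : is_derive t 1 (fun t : R => 1 - t) (0 - 1) by exact: is_deriveB.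
  have d2 := is_derive1_ln t10.
  have d3 := is_deriveN (@is_derive1_comp R (@ln R) (fun t : R => 1 - t) t _ _ d2 d1).
  by apply: is_derive_eq; rewrite sub0r mulrN1 opprK.
have -> := integral_is_derive r20 dF cf.
by rewrite /log_weight subr0 ln1 oppr0 subr0 div1r lnV// posrE subr_gt0.
Qed.

End disk_integrals.

(** * The Taylor expansion of the Bergman kernel *)

Section elementary.
Context {R : realType}.

Lemma normcD_le (x y : R[i]) : cmod (x + y) <= cmod x + cmod y.
Proof. exact: (@le_normcD R x y). Qed.

Lemma normcN_eq (x : R[i]) : cmod (- x) = cmod x.
Proof. exact: (@normcN R x). Qed.

Lemma normc_nat n : cmod (n%:R : R[i]) = n%:R.
Proof. by rewrite -(rmorph_nat (real_complex R)) normc_real normr_nat. Qed.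


(** Bernoulli's inequality for [(1 - x) ^- n], in multiplied form. *)
Lemma bernoulli_le1 (x : R) n : 0 <= x <= 1 -> (1 + n%:R * x) * (1 - x) ^+ n <= 1.
Proof.
move=> /andP[x0 x1]; elim: n => [|n IH]; first by rewrite mul0r addr0 mul1r expr0.
rewrite exprS mulrA; apply: le_trans IH; apply: ler_wpM2r.
  by rewrite exprn_ge0// subr_ge0.
have : 0 <= (n%:R + 1) * x ^+ 2 by rewrite mulr_ge0 ?sqr_ge0// addr_ge0.
rewrite -natr1; nra.
Qed.

Lemma cvg_natr_expr (rho : R) : 0 <= rho < 1 -> n%:R * rho ^+ n @[n --> \oo] --> (0 : R).
Proof.
move=> /andP[rho0 rho1].
pose s := Num.sqrt rho.
have s0 : 0 <= s by exact: sqrtr_ge0.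
have s1 : s < 1 by rewrite -(@sqrtr1 R) ltr_sqrt.
have rhoE : rho = s ^+ 2 by rewrite sqr_sqrtr.
have s10 : 0 < 1 - s by rewrite subr_gt0.
apply: (squeeze_cvgr (f := fun=> 0) (h := fun n => (1 - s)^-1 * s ^+ n)).
- near=> n; rewrite mulr_ge0 ?exprn_ge0//=.
  rewrite rhoE -exprM mulnC exprM expr2 mulrA; apply: ler_wpM2r; first exact: exprn_ge0.
  rewrite -[leRHS]mulr1 ler_pdivlMl//.
  have := @bernoulli_le1 (1 - s) n; rewrite subKr => /(_ _).
  have -> : 0 <= 1 - s <= 1 by rewrite ltW//= gerBl.
  move=> /(_ isT); have : 0 <= s ^+ n by exact: exprn_ge0.
  nra.
- exact: cvg_cst.
- rewrite -[X in _ --> X](mulr0 (1 - s)^-1); apply: cvgM; first exact: cvg_cst.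
  by apply: cvg_expr; rewrite ger0_norm.
Unshelve. all: by end_near. Qed.

(** The remainder of the Taylor expansion of [(1 - u) ^- 2]. *)
Lemma bergman_kernel_tail (u : R[i]) N : u != 1 ->
  (1 - u) ^- 2 - \sum_(n < N) n.+1%:R * u ^+ n
  = u ^+ N * (N.+1%:R - N%:R * u) / (1 - u) ^+ 2.
Proof.
move=> u1; have u10 : (1 - u) ^+ 2 != 0 by rewrite expf_eq0/= subr_eq0 eq_sym.
apply: (mulIf u10); rewrite mulrBl mulVf// mulfVK//.
elim: N => [|N IH]; first by rewrite big_ord0 expr0; ring.
rewrite big_ord_recr/= mulrDl opprD addrA IH -!natr1 (exprS u N); ring.
Qed.

(** A bound for the modulus of that remainder on the disk of radius [rho]. *)
Definition tail_bound (rho : R) (N : nat) : R :=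
  (2 * (N%:R * rho ^+ N) + rho ^+ N) / (1 - rho) ^+ 2.

Lemma cvg_tail_bound (rho : R) : 0 <= rho < 1 -> tail_bound rho N @[N --> \oo] --> (0 : R).
Proof.
move=> rho01; have /andP[rho0 rho1] := rho01.
rewrite -[X in _ --> X](mul0r ((1 - rho) ^- 2)) -[X in X * _](addr0 (0 : R)).
apply: cvgM; last exact: cvg_cst.
apply: cvgD; last by apply: cvg_expr; rewrite ger0_norm.
rewrite -[X in _ --> X](mulr0 (2 : R)); apply: cvgM; first exact: cvg_cst.
exact: cvg_natr_expr.
Qed.

Lemma normc_tail_le (u : R[i]) (rho : R) N : rho < 1 -> cmod u <= rho ->
  cmod ((1 - u) ^- 2 - \sum_(n < N) n.+1%:R * u ^+ n) <= tail_bound rho N.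
Proof.
move=> rho1 urho; have rho0 : 0 <= rho by rewrite (le_trans _ urho)// normc_ge0.
have u1 : u != 1.
  by apply/eqP => u1; move: urho; rewrite u1 ComplexField.Normc.normc1 leNgt rho1.
have d1 : 1 - rho <= cmod (1 - u).
  have := normcD_le (1 - u) u; rewrite subrK ComplexField.Normc.normc1; lra.
rewrite bergman_kernel_tail// !ComplexField.Normc.normcM ComplexField.Normc.normcV !normcX.
rewrite /tail_bound ler_pM//.
- by rewrite mulr_ge0 ?exprn_ge0 ?normc_ge0.
- by rewrite invr_ge0 exprn_ge0// normc_ge0.
- have -> : 2 * (N%:R * rho ^+ N) + rho ^+ N = rho ^+ N * (N.+1%:R + N%:R).
    by rewrite -natr1; ring.
  apply: ler_pM; rewrite ?exprn_ge0 ?normc_ge0//.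
    by rewrite lerXn2r ?nnegrE ?normc_ge0.
  apply: le_trans (normcD_le _ _) _; rewrite normcN_eq ComplexField.Normc.normcM !normc_nat.
  by rewrite lerD2l ler_piMr ?ler0n// (le_trans urho)// ltW.
- rewrite lef_pV2 ?posrE ?exprn_gt0 ?subr_gt0//; last first.
    by rewrite (lt_le_trans _ d1)// subr_gt0.
  by rewrite lerXn2r ?nnegrE ?normc_ge0// subr_ge0 ltW.
Qed.

End elementary.

(** * The Bergman projection of a bounded density *)

Lemma cvg_dist_le (R : realType) (u e : nat -> R) (l : R) :
  (forall n, `|l - u n| <= e n) -> e n @[n --> \oo] --> (0 : R) ->
  u n @[n --> \oo] --> l.
Proof.
move=> ue e0.
apply: (squeeze_cvgr (f := fun n => l - e n) (h := fun n => l + e n)).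
- near=> n; have := ue n; rewrite ler_norml; lra.
- by rewrite -[X in _ --> X](subr0 l); apply: cvgB => //; exact: cvg_cst.
- by rewrite -[X in _ --> X](addr0 l); apply: cvgD => //; exact: cvg_cst.
Unshelve. all: by end_near. Qed.

Section complex_integral.
Context {R : realType}.
Local Notation D := (@disk R 1).

Lemma bounded_integrable (A : set (plane R)) (f : plane R -> R) (K : R) :
  measurable A -> (area R A < +oo)%E -> measurable_fun A f ->
  (forall p, A p -> `|f p| <= K) -> (area R).-integrable A (EFin \o f).
Proof.
move=> mA Aoo mf fK; apply: measurable_bounded_integrable => //.
exists K; split; first exact: num_real.
by move=> x Kx p Ap; exact: le_trans (fK _ Ap) (ltW Kx).
Qed.

Lemma area_disk_fin (r : R) : 0 <= r -> (area R (disk r) < +oo)%E.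
Proof. by move=> r0; rewrite area_disk// ltry. Qed.

(** Integrability on the unit disk of both parts of a complex function. *)
Definition cintegrable (F : R[i] -> R[i]) :=
  (area R).-integrable D (EFin \o (fun p => complex.Re (F (to_complex p)))) /\
  (area R).-integrable D (EFin \o (fun p => complex.Im (F (to_complex p)))).

Lemma bounded_cintegrable (F : R[i] -> R[i]) (K : R) :
  cmeasurable_fun D (fun p => F (to_complex p)) ->
  (forall p, D p -> cmod (F (to_complex p)) <= K) -> cintegrable F.
Proof.
have mD : measurable D by exact: measurable_disk.
move=> [m1 m2] FK; split; apply: (bounded_integrable mD (area_disk_fin ler01) _ (K := K)) => // p Dp.
  exact: le_trans (normr_Re_le _) (FK _ Dp).
exact: le_trans (normr_Im_le _) (FK _ Dp).
Qed.

Lemma cintegralZ (c : R[i]) (F : R[i] -> R[i]) : cintegrable F ->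
  cintegral D (fun w => c * F w) = c * cintegral D F.
Proof.
have mD : measurable D by exact: measurable_disk.
move=> [i1 i2]; rewrite /cintegral; apply: complex_ext => /=.
  rewrite complexReM/= -!RintegralZl// -RintegralB//.
  - by apply: eq_Rintegral => p _; rewrite complexReM.
  - exact: (integrableZl mD _ i1).
  - exact: (integrableZl mD _ i2).
rewrite complexImM/= -!RintegralZl// -RintegralD//.
- by apply: eq_Rintegral => p _; rewrite complexImM.
- exact: (integrableZl mD _ i2).
- exact: (integrableZl mD _ i1).
Qed.

Lemma cintegral_sum N (F : nat -> R[i] -> R[i]) : (forall n, cintegrable (F n)) ->
  cintegral D (fun w => \sum_(n < N) F n w) = \sum_(n < N) cintegral D (F n).
Proof.
have mD : measurable D by exact: measurable_disk.
move=> iF; rewrite /cintegral; apply: complex_ext.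
  rewrite complexRe_sum/=.
  have [_ <-] := Rintegral_sum N mD (fun n => (iF n).1).
  by apply: eq_Rintegral => p _; rewrite complexRe_sum.
rewrite complexIm_sum/=.
have [_ <-] := Rintegral_sum N mD (fun n => (iF n).2).
by apply: eq_Rintegral => p _; rewrite complexIm_sum.
Qed.

Lemma cintegralB (F G : R[i] -> R[i]) : cintegrable F -> cintegrable G ->
  cintegral D (fun w => F w - G w) = cintegral D F - cintegral D G.
Proof.
have mD : measurable D by exact: measurable_disk.
move=> [F1 F2] [G1 G2]; rewrite /cintegral; apply: complex_ext => /=.
  by rewrite -RintegralB//; apply: eq_Rintegral => p _; case: (F _); case: (G _).
by rewrite -RintegralB//; apply: eq_Rintegral => p _; case: (F _); case: (G _).
Qed.

(** The unit disk has area 1, so a bound on the integrand bounds both parts of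
    the integral. *)
Lemma normr_parts_cintegral_le (F : R[i] -> R[i]) (K : R) :
  cmeasurable_fun D (fun p => F (to_complex p)) ->
  (forall p, D p -> cmod (F (to_complex p)) <= K) ->
  `|complex.Re (cintegral D F)| <= K /\ `|complex.Im (cintegral D F)| <= K.
Proof.
have mD : measurable D by exact: measurable_disk.
move=> mF FK; have [i1 i2] := bounded_cintegrable mF FK.
have iK : (area R).-integrable D (EFin \o (fun=> K)).
  apply: (bounded_integrable mD (area_disk_fin ler01) _ (K := `|K|)) => //.
have KE : (\int[area R]_(p in D) K = K)%R.
  by rewrite Rintegral_cst// area_disk//= expr1n mulr1.
rewrite /cintegral/= -KE; split.
  apply: le_trans (le_normr_Rintegral mD i1) _; apply: le_Rintegral => //.
  - exact: integrable_norm.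
  - by move=> p Dp; exact: le_trans (normr_Re_le _) (FK _ Dp).
apply: le_trans (le_normr_Rintegral mD i2) _; apply: le_Rintegral => //.
- exact: integrable_norm.
- by move=> p Dp; exact: le_trans (normr_Im_le _) (FK _ Dp).
Qed.

End complex_integral.

Section bergman_kernel.
Context {R : realType}.
Local Notation D := (@disk R 1).
Variable z : R[i].
Hypothesis z1 : cmod z < 1.

(** Partial sums of the expansion of the Bergman kernel. *)
Definition kernel_sum (k : nat) (w : R[i]) : R[i] :=
  \sum_(n < k) n.+1%:R * (z * w^*) ^+ n.

Lemma cmeasurable_kernel_sum k : cmeasurable_fun D (fun p => kernel_sum k (to_complex p)).
Proof.
apply: (@cmeasurable_fun_sum _ _ _ _ _ (fun n p => n.+1%:R * (z * (to_complex p)^*) ^+ n)) => n.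
apply: cmeasurable_funM; first exact: cmeasurable_cst.
apply: cmeasurable_funX; apply: cmeasurable_funM; first exact: cmeasurable_cst.
apply: cmeasurable_fun_conj.
by have [a b] := @cmeasurable_to_complex R; split; exact: measurable_funTS.
Qed.

Lemma kernel_sum_tail k p : D p ->
  cmod ((1 - z * (to_complex p)^*) ^- 2 - kernel_sum k (to_complex p)) <= tail_bound (cmod z) k.
Proof.
move=> Dp; apply: normc_tail_le => //.
by rewrite ComplexField.Normc.normcM normc_conj ler_piMr ?normc_ge0// ltW.
Qed.

(** The kernel is measurable as a limit of its partial sums, so that division of
    complex functions need not be considered. *)
Lemma cmeasurable_kernel : cmeasurable_fun D (fun p => (1 - z * (to_complex p)^*) ^- 2).
Proof.
have rho01 : 0 <= cmod z < 1 by rewrite normc_ge0.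
split.
  apply: (@measurable_fun_cvg _ _ _ D (fun k p => complex.Re (kernel_sum k (to_complex p)))).
    by move=> k; exact: (cmeasurable_kernel_sum k).1.
  move=> p Dp; apply: cvg_dist_le (cvg_tail_bound rho01) => k.
  apply: le_trans (kernel_sum_tail k Dp).
  rewrite (_ : _ - _ = complex.Re ((1 - z * (to_complex p)^*) ^- 2 - kernel_sum k (to_complex p))).
    exact: normr_Re_le.
  by case: (_ ^- 2) => ? ?; case: (kernel_sum _ _).
apply: (@measurable_fun_cvg _ _ _ D (fun k p => complex.Im (kernel_sum k (to_complex p)))).
  by move=> k; exact: (cmeasurable_kernel_sum k).2.
move=> p Dp; apply: cvg_dist_le (cvg_tail_bound rho01) => k.
apply: le_trans (kernel_sum_tail k Dp).
rewrite (_ : _ - _ = complex.Im ((1 - z * (to_complex p)^*) ^- 2 - kernel_sum k (to_complex p))).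
  exact: normr_Im_le.
by case: (_ ^- 2) => ? ?; case: (kernel_sum _ _).
Qed.

End bergman_kernel.

Section bounded_density.
Context {R : realType}.
Local Notation D := (@disk R 1).
Variables (mu : R[i] -> R[i]) (M : R).
Hypothesis mmu : cmeasurable_fun D (fun p => mu (to_complex p)).
Hypothesis muM : forall p, D p -> cmod (mu (to_complex p)) <= M.

Let M0 : 0 <= M.
Proof.
apply: le_trans (muM (_ : D (0, 0))); first exact: normc_ge0.
by rewrite /disk /mkset/= expr0n/= addr0 sqrtr0.
Qed.

(** The [n]-th Taylor coefficient of the Bergman projection. *)
Definition bergman_coef (n : nat) : R[i] :=
  n.+1%:R * cintegral D (fun w => mu w * w^* ^+ n).

Let cmeas_conjX n : cmeasurable_fun D (fun p => mu (to_complex p) * (to_complex p)^* ^+ n).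
Proof.
apply: cmeasurable_funM => //; apply: cmeasurable_funX; apply: cmeasurable_fun_conj.
by have [a b] := @cmeasurable_to_complex R; split; exact: measurable_funTS.
Qed.

Let conjX_le n p : D p -> cmod (mu (to_complex p) * (to_complex p)^* ^+ n) <= M.
Proof.
move=> Dp; rewrite ComplexField.Normc.normcM normcX normc_conj -[leRHS]mulr1.
apply: ler_pM; rewrite ?exprn_ge0 ?normc_ge0//; first exact: muM.
by rewrite exprn_ile1 ?normc_ge0// ltW.
Qed.

Let int_conjX n : cintegrable (fun w => mu w * w^* ^+ n).
Proof. exact: bounded_cintegrable (@cmeas_conjX n) (@conjX_le n). Qed.

Let cintegralZ_conjX c n :
  cintegral D (fun w => mu w * (c * w^* ^+ n)) = c * cintegral D (fun w => mu w * w^* ^+ n).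
Proof.
rewrite -cintegralZ//; congr (cintegral _ _); apply/funext => w; ring.
Qed.

Let int_Z_conjX c n : cintegrable (fun w => mu w * (c * w^* ^+ n)).
Proof.
have -> : (fun w => mu w * (c * w^* ^+ n)) = (fun w => c * (mu w * w^* ^+ n)).
  by apply/funext => w; ring.
apply: (@bounded_cintegrable _ _ (cmod c * M)).
  by apply: cmeasurable_funM; [exact: cmeasurable_cst|exact: cmeas_conjX].
move=> p Dp; rewrite ComplexField.Normc.normcM ler_wpM2l ?normc_ge0//; exact: conjX_le.
Qed.

(** Duality: the mean square of the partial sums of the projection on the circle
    of radius [r] is a pairing of [mu] with a polynomial. *)
Lemma bergman_coef_duality (r : R) N : 0 <= r ->
  \sum_(n < N) cmod (bergman_coef n) ^+ 2 * (r ^+ 2) ^+ n <=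
  M * Rintegral (area R) D (fun p => cmod (\sum_(n < N)
    n.+1%:R * bergman_coef n * ((r ^+ 2) ^+ n)%:C * to_complex p ^+ n)).
Proof.
move=> r0; have mD : measurable D by exact: measurable_disk.
pose a := bergman_coef.
pose F w : R[i] := \sum_(n < N) n.+1%:R * a n * ((r ^+ 2) ^+ n)%:C * w ^+ n.
pose G w : R[i] := \sum_(n < N) mu w * ((n.+1%:R * a n * ((r ^+ 2) ^+ n)%:C)^* * w^* ^+ n).
have GE w : G w = mu w * (F w)^*.
  rewrite /F conjc_sum mulr_sumr.
  by apply: eq_bigr => n _; rewrite [in RHS]conjcM conjcX.
have -> : \sum_(n < N) cmod (bergman_coef n) ^+ 2 * (r ^+ 2) ^+ n = complex.Re (cintegral D G).
  rewrite (@cintegral_sum _ N (fun n w =>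
    mu w * ((n.+1%:R * a n * ((r ^+ 2) ^+ n)%:C)^* * w^* ^+ n)))//.
  rewrite complexRe_sum; apply: eq_bigr => n _.
  rewrite cintegralZ_conjX sqr_normcE -/(a n).
  have -> : (n.+1%:R * a n * ((r ^+ 2) ^+ n)%:C)^* * cintegral D (fun w => mu w * w^* ^+ n)
     = ((r ^+ 2) ^+ n)%:C * (a n * (a n)^*).
    rewrite conjcM (conjcM n.+1%:R) conjc_natr conjc_re.
    transitivity (((r ^+ 2) ^+ n)%:C *
      ((n.+1%:R * cintegral D (fun w => mu w * w^* ^+ n)) * (a n)^*)) => //.
    ring.
  by rewrite [RHS]complexReM/= mul0r subr0 mulrC.
have mF : cmeasurable_fun D (fun p => F (to_complex p)).
  have [m1 m2] := cmeasurable_horner_sum (fun n => n.+1%:R * a n * ((r ^+ 2) ^+ n)%:C) N.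
  by split; exact: measurable_funTS.
have [K FK] : exists K, forall p, D p -> cmod (F (to_complex p)) <= K.
  exists (\sum_(n < N) cmod (n.+1%:R * a n * ((r ^+ 2) ^+ n)%:C)) => p Dp.
  rewrite /F; apply: (big_ind2 (fun (x : R[i]) y => cmod x <= y)).
  - by rewrite ComplexField.Normc.normc0.
  - by move=> x1 x2 y1 y2 h1 h2; apply: le_trans (normcD_le _ _) _; exact: lerD.
  - move=> n _; rewrite ComplexField.Normc.normcM ler_piMr ?normc_ge0// normcX.
    by rewrite exprn_ile1 ?normc_ge0// ltW.
have iF : (area R).-integrable D (EFin \o (fun p => cmod (F (to_complex p)))).
  apply: (bounded_integrable mD (area_disk_fin ler01) (measurable_fun_normc mF) (K := K)) => p Dp.
  by rewrite ger0_norm ?normc_ge0// FK.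
have mG : cmeasurable_fun D (fun p => G (to_complex p)).
  under eq_fun do rewrite GE.
  by apply: cmeasurable_funM => //; exact: cmeasurable_fun_conj.
have GF p : D p -> cmod (G (to_complex p)) <= M * cmod (F (to_complex p)).
  by move=> Dp; rewrite GE ComplexField.Normc.normcM normc_conj ler_wpM2r ?normc_ge0// muM.
have [iG _] : cintegrable G.
  apply: (bounded_cintegrable mG (K := M * K)) => p Dp.
  by rewrite (le_trans (GF _ Dp))// ler_wpM2l// FK.
rewrite -RintegralZl// /cintegral/=; apply: le_Rintegral => //.
  exact: (integrableZl mD _ iF).
move=> p Dp; apply: le_trans (GF _ Dp).
by apply: le_trans (normr_Re_le _); exact: ler_norm.
Qed.

(** On the open disk the Taylor series of the projection converges to it. *)
Lemma bergman_partial_sums (z : R[i]) N : cmod z < 1 ->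
  `|complex.Re (bergman mu z - \sum_(n < N) bergman_coef n * z ^+ n)|
    <= M * tail_bound (cmod z) N /\
  `|complex.Im (bergman mu z - \sum_(n < N) bergman_coef n * z ^+ n)|
    <= M * tail_bound (cmod z) N.
Proof.
move=> z1; have mD : measurable D by exact: measurable_disk.
pose P := kernel_sum z.
have mP := cmeasurable_kernel_sum z.
have mK := cmeasurable_kernel z1.
have tail := kernel_sum_tail z1.
pose K w := mu w * (1 - z * w^*) ^- 2.
have mKmu : cmeasurable_fun D (fun p => K (to_complex p)) by exact: cmeasurable_funM.
have mPmu : cmeasurable_fun D (fun p => mu (to_complex p) * P N (to_complex p)).
  exact: cmeasurable_funM.
have KP p : D p -> cmod (K (to_complex p) - mu (to_complex p) * P N (to_complex p)) <=
    M * tail_bound (cmod z) N.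
  move=> Dp; rewrite -mulrBr ComplexField.Normc.normcM.
  by apply: ler_pM; rewrite ?normc_ge0//; [exact: muM|exact: tail].
have P0 p : kernel_sum z 0 (to_complex p) = 0 by rewrite /kernel_sum big_ord0.
have iK : cintegrable K.
  apply: (bounded_cintegrable mKmu (K := M * tail_bound (cmod z) 0)) => p Dp.
  rewrite ComplexField.Normc.normcM ler_pM ?normc_ge0//; first exact: muM.
  by have := tail 0 p Dp; rewrite P0 subr0.
have iP : cintegrable (fun w => mu w * P N w).
  apply: (bounded_cintegrable mPmu
    (K := M * tail_bound (cmod z) 0 + M * tail_bound (cmod z) N)) => p Dp.
  rewrite -[X in cmod X](subKr (K (to_complex p))).
  apply: le_trans (normcD_le _ _) _; rewrite normcN_eq; apply: lerD; last exact: KP.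
  rewrite ComplexField.Normc.normcM ler_pM ?normc_ge0//; first exact: muM.
  by have := tail 0 p Dp; rewrite P0 subr0.
have -> : bergman mu z - \sum_(n < N) bergman_coef n * z ^+ n =
    cintegral D (fun w => K w - mu w * P N w).
  rewrite cintegralB//; congr (_ - _).
  transitivity (cintegral D (fun w => \sum_(n < N)
      mu w * ((n.+1%:R * z ^+ n) * w^* ^+ n))); last first.
    congr (cintegral _ _); apply/funext => w; rewrite mulr_sumr.
    by apply: eq_bigr => n _; rewrite exprMn; ring.
  rewrite (@cintegral_sum _ N (fun n w => mu w * ((n.+1%:R * z ^+ n) * w^* ^+ n)))//.
  by apply: eq_bigr => n _; rewrite cintegralZ_conjX /bergman_coef; ring.
apply: normr_parts_cintegral_le => //.
have -> : (fun p => K (to_complex p) - mu (to_complex p) * P N (to_complex p)) =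
   (fun p => K (to_complex p) + (-1) * (mu (to_complex p) * P N (to_complex p))).
  by apply/funext => p; rewrite mulN1r.
apply: cmeasurable_funD => //; apply: cmeasurable_funM => //; exact: cmeasurable_cst.
Qed.

End bounded_density.

(** * The discrepancy of a polynomial *)

Section discrepancy_bound.
Context {R : realType}.
Variable r : R.
Hypothesis r01 : 0 < r < 1.
Local Notation Dr := (@disk R r).

Let r0 : 0 < r. Proof. by have /andP[] := r01. Qed.
Let r1 : r < 1. Proof. by have /andP[] := r01. Qed.
Let mDr : measurable Dr. Proof. by apply: measurable_disk; rewrite ltW. Qed.
Let r21 : r ^+ 2 < 1. Proof. by rewrite expr_lt1// ltW. Qed.
Let r20 : 0 < r ^+ 2. Proof. by rewrite exprn_gt0. Qed.

Lemma log_weight_gt0 : 0 < log_weight r.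
Proof.
rewrite /log_weight ln_gt0// ltr_pdivlMr ?subr_gt0// mul1r.
by rewrite gtrBl.
Qed.

(** The minimal discrepancy on the disk of radius [s]. *)
Definition rho_at (s : R) : \bar R := ereal_inf (range (@discrepancy R s)).

Lemma rho_at_ge0 : (0 <= rho_at r)%E.
Proof.
apply: le_ereal_inf_tmp => _ [f _ <-]; apply: mule_ge0.
  by rewrite lee_fin invr_ge0 ltW// log_weight_gt0.
apply: integral_ge0 => p; rewrite /disk /mkset => pr; rewrite lee_fin.
by rewrite divr_ge0 ?sqr_ge0// subr_ge0 expr_le1 ?normc_ge0// ltW// (lt_trans pr).
Qed.

Lemma rho_at_le1 : (rho_at r <= 1)%E.
Proof.
apply: (@le_trans _ _ (discrepancy r 0)); first by apply: ereal_inf_lbound; exists 0.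
rewrite /discrepancy.
rewrite (_ : (\int[_]_(p in _) _)%E = (log_weight r)%:E).
  by rewrite -EFinM mulVf// gt_eqF// log_weight_gt0.
rewrite -integral_disk_hyperbolic//; apply: eq_integral => p _.
by rewrite horner0 ComplexField.Normc.normc0 mulr0 sub0r sqrrN expr1n div1r.
Qed.

Section polynomial.
Variables (h : nat -> R[i]) (N : nat).
Let H (z : R[i]) : R[i] := \sum_(n < N) h n * z ^+ n.

Let mH : measurable_fun Dr (fun p => cmod (H (to_complex p))).
Proof.
by apply: measurable_funTS; exact: measurable_fun_normc (cmeasurable_horner_sum h N).
Qed.

Let H_le p : Dr p -> cmod (H (to_complex p)) <= \sum_(n < N) cmod (h n).
Proof.
move=> Dp; rewrite /H; apply: (big_ind2 (fun (x : R[i]) y => cmod x <= y)).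
- by rewrite ComplexField.Normc.normc0.
- by move=> x1 x2 y1 y2 h1 h2; apply: le_trans (normcD_le _ _) _; exact: lerD.
- move=> n _; rewrite ComplexField.Normc.normcM ler_piMr ?normc_ge0// normcX.
  by rewrite exprn_ile1 ?normc_ge0// ltW// (lt_trans Dp).
Qed.

Let msq : measurable_fun Dr (fun p => 1 - cmod (to_complex p) ^+ 2).
Proof.
apply: measurable_funB => //; apply: measurable_funX.
by apply: measurable_funTS; exact: measurable_fun_normc (@cmeasurable_to_complex R).
Qed.

Let iH : (area R).-integrable Dr (EFin \o (fun p => cmod (H (to_complex p)))).
Proof.
apply: (bounded_integrable mDr (area_disk_fin (ltW r0)) mH (K := \sum_(n < N) cmod (h n))) => p Dp.
by rewrite ger0_norm ?normc_ge0// H_le.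
Qed.

Let weight_ge0 p : Dr p -> 0 < 1 - cmod (to_complex p) ^+ 2.
Proof.
by move=> Dp; rewrite subr_gt0 expr_lt1 ?normc_ge0// (lt_trans Dp).
Qed.

Let A : R := \sum_(n < N) cmod (h n) ^+ 2 *
     ((r ^+ 2) ^+ n.+1 / n.+1%:R - (r ^+ 2) ^+ n.+2 / n.+2%:R).
Let B : R := Rintegral (area R) Dr (fun p => cmod (H (to_complex p))).

(** Testing the infimum with [c H] and expanding the square; [A] is the weighted
    square norm of [H] and [B] the integral of [|H|]. *)
Lemma rho_at_quadratic (c : R) : 0 <= c ->
  fine (rho_at r) * log_weight r <= c ^+ 2 * A - 2 * c * B + log_weight r.
Proof.
move=> c0.
pose f : {poly R[i]} := \poly_(n < N) (c%:C * h n).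
have fE p : cmod f.[to_complex p] = c * cmod (H (to_complex p)).
  transitivity (cmod (c%:C * H (to_complex p))); last first.
    by rewrite ComplexField.Normc.normcM normc_real ger0_norm.
  rewrite /f horner_poly /H mulr_sumr; congr cmod.
  by apply: eq_bigr => n _; rewrite mulrA.
pose w p := 1 - cmod (@to_complex R p) ^+ 2.
pose f1 p := w p * cmod (H (to_complex p)) ^+ 2.
have If1 : (\int[area R]_(p in Dr) (f1 p)%:E = A%:E)%E by exact: integral_disk_weighted.
have If3 : (\int[area R]_(p in Dr) ((w p)^-1)%:E = (log_weight r)%:E)%E.
  exact: integral_disk_hyperbolic.
(* On the disk [w > 0], so that the inverse of [w] is [exp (- ln w)]. *)
have mw1 : measurable_fun Dr (fun p => (w p)^-1).
  apply: (@eq_measurable_fun _ _ _ _ Dr (fun p => expR (- ln (w p)))).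
    by move=> p /set_mem Dp; rewrite expRN lnK// posrE weight_ge0.
  by apply: measurableT_comp => //; apply: measurable_funN; exact: measurableT_comp.
have mf1 : measurable_fun Dr f1 by apply: measurable_funM => //; exact: measurable_funX.
have if1 : (area R).-integrable Dr (EFin \o f1).
  apply/integrableP; split; first exact/measurable_EFinP.
  rewrite (_ : (\int[_]_(x in _) _)%E = A%:E) ?ltry// -If1; apply: eq_integral => p /set_mem Dp.
  by rewrite /= ger0_norm// mulr_ge0 ?sqr_ge0// ltW// weight_ge0.
have if3 : (area R).-integrable Dr (EFin \o (fun p => (w p)^-1)).
  apply/integrableP; split; first exact/measurable_EFinP.
  rewrite (_ : (\int[_]_(x in _) _)%E = (log_weight r)%:E) ?ltry// -If3.
  apply: eq_integral => p /set_mem Dp.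
  by rewrite /= ger0_norm// invr_ge0 ltW// weight_ge0.
have iE1 := integrableZl mDr (c ^+ 2) if1.
have iE2 := integrableZl mDr (2 * c) iH.
have D_E : discrepancy r f =
    ((log_weight r)^-1 * (c ^+ 2 * A - 2 * c * B + log_weight r))%:E.
  rewrite /discrepancy EFinM; congr (_ * _)%E.
  transitivity (\int[area R]_(p in Dr)
    ((c ^+ 2 * f1 p - (2 * c) * cmod (H (to_complex p)) + (w p)^-1)%:E))%E.
    apply: eq_integral => p /set_mem Dp; congr EFin; rewrite fE -/(w p) /f1.
    by have := weight_ge0 Dp; rewrite -/(w p) => w0; field; rewrite gt_eqF.
  have iE12 : (area R).-integrable Dr (EFin \o
      (fun p => c ^+ 2 * f1 p - (2 * c) * cmod (H (to_complex p)))).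
    exact: (integrableB mDr iE1 iE2).
  rewrite -[LHS]fineK; last exact: integrable_fin_num (integrableD mDr iE12 if3).
  congr EFin; rewrite -[LHS]/(Rintegral _ _ _) RintegralD// RintegralB// !RintegralZl//.
  by rewrite /Rintegral If1 If3.
have L0 := log_weight_gt0.
rewrite -ler_pdivlMr//.
have : (rho_at r <= discrepancy r f)%E by apply: ereal_inf_lbound; exists f.
rewrite D_E -[X in (X <= _)%E]fineK ?lee_fin; first by rewrite mulrC.
by rewrite ge0_fin_numE ?rho_at_ge0// (le_lt_trans rho_at_le1)// ltry.
Qed.

End polynomial.
End discrepancy_bound.

(** * The estimate on a single circle *)

(** The change of variables [z |-> r z], from the unit disk to the disk of radius
    [r]. *)
Lemma Rintegral_disk_dilation (R : realType) (r : R) (f : R[i] -> R) : 0 < r ->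
  measurable_fun (disk r) (fun p => f (to_complex p)) -> (forall z, 0 <= f z) ->
  (Rintegral (area R) (disk r) (fun p => f (to_complex p)) =
   r ^+ 2 * Rintegral (area R) (disk 1) (fun p => f (r%:C * to_complex p))).
Proof.
move=> r0 mf f0.
have mDr : measurable (@disk R r) by apply: measurable_disk; rewrite ltW.
have E : (fun p : plane R => (r * p.1, r * p.2)) @^-1` disk r = disk 1.
  apply/funext => p; apply/propext; rewrite /disk /mkset /preimage /mkset.
  rewrite !lt_normc_sqn ?ltW// /sqn/= !exprMn -mulrDr expr1n.
  by rewrite -ltr_pdivlMl ?exprn_gt0// mulVf// gt_eqF// exprn_gt0.
have mF : measurable_fun (disk r) (fun p : plane R => (f (to_complex p))%:E).
  exact/measurable_EFinP.
have F0 (p : plane R) : disk r p -> (0 <= (f (to_complex p))%:E)%E.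
  by move=> _; rewrite lee_fin.
have := ge0_integral_scales_area (sqr_ge0 r) (scales_area_homothety r0) mDr mF F0.
rewrite E /Rintegral => ->.
have -> : (\int[area R]_(p in disk 1) (f (to_complex (r * p.1, r * p.2)))%:E =
  \int[area R]_(p in disk 1) (f (r%:C * to_complex p))%:E)%E.
  apply: eq_integral => p _; congr (f _)%:E.
  by rewrite /to_complex; simpc.
have [->|x0] := eqVneq (\int[area R]_(p in disk 1) (f (r%:C * to_complex p))%:E)%E +oo%E.
  by rewrite mulr_infty gtr0_sg ?exprn_gt0// mul1e/= mulr0.
rewrite fineM// ge0_fin_numE ?lt_neqAle ?x0 ?leey//.
by apply: integral_ge0 => p _; rewrite lee_fin.
Qed.

Section bounded_projection.
Context {R : realType}.
Local Notation D := (@disk R 1).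
Variables (mu : R[i] -> R[i]) (M r : R).
Hypothesis mmu : cmeasurable_fun D (fun p => mu (to_complex p)).
Hypothesis muM : forall p, D p -> cmod (mu (to_complex p)) <= M.
Hypothesis r01 : 0 < r < 1.
Local Notation a := (bergman_coef mu).

Let r0 : 0 < r. Proof. by have /andP[] := r01. Qed.
Let r1 : r < 1. Proof. by have /andP[] := r01. Qed.

Let C : R := (M / r ^+ 2) ^+ 2 * (1 - fine (rho_at r)) * log_weight r.

(** Write [S] for the left-hand side. Duality gives [S <= (M / r^2) B], where [B]
    is the integral of [|H|] over the disk of radius [r], [H] having coefficients
    [(n + 1) a n r^n]. Bernoulli's inequality shows that the weighted square norm
    [A] of [H] on that disk is at most [S]. Inserting both facts in the quadratic
    inequality for the discrepancy gives the bound. *)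
Lemma bergman_coef_bound N :
  \sum_(n < N) cmod (a n) ^+ 2 * (r ^+ 2) ^+ n <= C.
Proof.
set S := \sum_(n < N) _.
pose h n : R[i] := n.+1%:R * a n * (r ^+ n)%:C.
pose B := Rintegral (area R) (disk r) (fun p => cmod (\sum_(n < N) h n * to_complex p ^+ n)).
pose A := \sum_(n < N) cmod (h n) ^+ 2 *
     ((r ^+ 2) ^+ n.+1 / n.+1%:R - (r ^+ 2) ^+ n.+2 / n.+2%:R).
have x0 : 0 < r ^+ 2 by rewrite exprn_gt0.
have x1 : r ^+ 2 < 1 by rewrite expr_lt1// ltW.
have SB : S <= M / r ^+ 2 * B.
  apply: le_trans (bergman_coef_duality mmu muM N (ltW r0)) _.
  rewrite le_eqVlt; apply/orP; left; apply/eqP.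
  rewrite -mulrA; congr (_ * _); rewrite /B.
  rewrite (@Rintegral_disk_dilation _ r (fun z => cmod (\sum_(n < N) h n * z ^+ n)))//.
  - rewrite (mulKf (lt0r_neq0 x0)).
    apply: eq_Rintegral => p _.
    congr cmod.
    have rX (x : R) k : (x ^+ k)%:C = x%:C ^+ k := rmorphXn (real_complex R) k x.
    apply: eq_bigr => n _; rewrite /h -exprM mulnC exprM !rX exprMn; ring.
  - by apply: measurable_funTS; exact: measurable_fun_normc (cmeasurable_horner_sum h N).
  - by move=> z; exact: normc_ge0.
(* Termwise, with [x = r^2] and [y = 1 - x], this is
   [(1 + (n + 1) y) x^(n + 1) <= 1]. *)
have AS : A <= S.
  apply: ler_sum => n _; set d := (_ - _).
  have -> : cmod (h n) ^+ 2 * d = cmod (a n) ^+ 2 * (r ^+ 2) ^+ n * (n.+1%:R ^+ 2 * d).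
    rewrite /h !ComplexField.Normc.normcM normc_nat normc_real.
    rewrite ger0_norm ?exprn_ge0 ?(ltW r0)// -(exprM r 2 n) mulnC (exprM r n 2); ring.
  rewrite -[leRHS]mulr1; apply: ler_wpM2l.
    by apply: mulr_ge0; [exact: sqr_ge0|rewrite exprn_ge0// ltW].
  rewrite /d.
  set x := r ^+ 2; pose y := 1 - x.
  have y01 : 0 <= y <= 1 by rewrite /y /x subr_ge0 (ltW x1) gerBl ltW.
  have := bernoulli_le1 n.+1 y01; rewrite {2}/y subKr; apply: le_trans.
  have n2 : n.+2%:R != 0 :> R by rewrite pnatr_eq0.
  have n1 : n.+1%:R != 0 :> R by rewrite pnatr_eq0.
  have -> : n.+1%:R ^+ 2 * (x ^+ n.+1 / n.+1%:R - x ^+ n.+2 / n.+2%:R) =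
     (n.+1%:R / n.+2%:R) * ((1 + n.+1%:R * y) * x ^+ n.+1).
    rewrite /y (exprS x n.+1); move: n1 n2; rewrite -!natr1 => n1 n2; field.
    by rewrite n1 n2.
  apply: ler_piMl; last by rewrite ler_pdivrMr ?ltr0n// mul1r ler_nat.
  apply: mulr_ge0; last by rewrite exprn_ge0// ltW.
  by apply: addr_ge0 => //; apply: mulr_ge0 => //; have /andP[] := y01.
pose m := M / r ^+ 2.
have := rho_at_quadratic r01 h N; rewrite -/A -/B => Q.
have M0 : 0 <= M.
  apply: le_trans (muM (_ : D (0, 0))); first exact: normc_ge0.
  by rewrite /disk /mkset/= expr0n/= addr0 sqrtr0.
have m0 : 0 <= m by rewrite divr_ge0// ltW.
rewrite /C -/m; rewrite -/m in SB.
have [mE|mN] := eqVneq m 0.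
  by move: SB; rewrite mE mul0r expr0n !mul0r.
have mp : 0 < m by rewrite lt_def mN.
(* [c = m^-1] is the scaling of [H] for which the terms in [S] combine to
   [- S / m^2]. *)
have {Q} := Q m^-1; rewrite invr_ge0 => /(_ m0) Q.
have {}SB : S / m <= B by rewrite ler_pdivrMr// mulrC.
have Q2 : fine (rho_at r) * log_weight r <= (m^-1) ^+ 2 * S - 2 * m^-1 * (S / m) + log_weight r.
  apply: le_trans Q _; rewrite lerD2r; apply: lerB.
    by apply: ler_wpM2l => //; exact: sqr_ge0.
  by apply: ler_wpM2l => //; rewrite mulr_ge0// invr_ge0.
have Q3 : S / m ^+ 2 <= (1 - fine (rho_at r)) * log_weight r.
  have E : (m^-1) ^+ 2 * S - 2 * m^-1 * (S / m) = - (S / m ^+ 2) by field.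
  rewrite E in Q2; lra.
by rewrite -mulrA -ler_pdivrMl ?exprn_gt0// mulrC.
Qed.

(** Mean squares of the projection on circles, through Fatou's lemma. *)
Lemma circle_integral_bergman_le :
  (circle_integral (fun zeta => cmod (dilate (bergman mu) r zeta) ^+ 2)%R <= C%:E)%E.
Proof.
pose circ : set (measurableTypeR R) := `[0%R, 2 * pi]%classic.
have pi2 : 0 < 2 * pi :> R by rewrite mulr_gt0// pi_gt0.
pose c n : R[i] := a n * (r%:C) ^+ n.
pose G N (t : measurableTypeR R) : R := cmod (\sum_(n < N) c n * expi t ^+ n) ^+ 2.
have intG N : (\int[@lebesgue_measure R]_(t in circ) (G N t)%:E <= (2 * pi * C)%:E)%E.
  rewrite /G (integral_circle_sum c N) lee_fin ler_pM2l//.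
  apply: le_trans (bergman_coef_bound N); rewrite le_eqVlt; apply/orP; left; apply/eqP.
  apply: eq_bigr => n _.
  by rewrite ComplexField.Normc.normcM normcX normc_real ger0_norm ?(ltW r0)// exprMn -!exprM mulnC.
have mG N : measurable_fun circ (fun t => (G N t)%:E).
  apply/measurable_EFinP/measurable_funTS/measurable_funX/measurable_fun_normc.
  apply: (@cmeasurable_fun_sum _ _ _ _ _ (fun n t => c n * expi t ^+ n)) => n.
  apply: cmeasurable_funM; first exact: cmeasurable_cst.
  exact: cmeasurable_funX (@measurable_expi R).
pose z t : R[i] := r%:C * expi t.
have zr t : cmod (z t) = r.
  by rewrite ComplexField.Normc.normcM normc_expi mulr1 normc_real ger0_norm// ltW.
have r01' : 0 <= r < 1 by rewrite r1 ltW.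
have cvgG t : (G N t)%:E @[N --> \oo] --> (cmod (bergman mu (z t)) ^+ 2)%:E.
  apply: cvg_EFin; first exact: nearW.
  have Gz N : \sum_(n < N) c n * expi t ^+ n = \sum_(n < N) a n * z t ^+ n.
    by apply: eq_bigr => n _; rewrite /c /z exprMn mulrA.
  pose e N := M * tail_bound r N.
  have e0 : e N @[N --> \oo] --> (0 : R).
    rewrite -[X in _ --> X](mulr0 M); apply: cvgM; first exact: cvg_cst.
    exact: cvg_tail_bound.
  have z1 : cmod (z t) < 1 by rewrite zr.
  rewrite /G; under eq_fun do rewrite sqr_normc_parts Gz.
  rewrite sqr_normc_parts.
  have cR : complex.Re (\sum_(n < N) a n * z t ^+ n) @[N --> \oo] --> complex.Re (bergman mu (z t)).
    apply: cvg_dist_le e0 => N; have [+ _] := bergman_partial_sums mmu muM N z1.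
    by rewrite zr; case: (bergman _ _) => ? ?; case: (\sum_(_ < _) _).
  have cI : complex.Im (\sum_(n < N) a n * z t ^+ n) @[N --> \oo] --> complex.Im (bergman mu (z t)).
    apply: cvg_dist_le e0 => N; have [_ +] := bergman_partial_sums mmu muM N z1.
    by rewrite zr; case: (bergman _ _) => ? ?; case: (\sum_(_ < _) _).
  by apply: cvgD; rewrite expr2; under eq_fun do rewrite expr2; exact: cvgM.
rewrite /circle_integral lee_pdivrMl//.
rewrite (_ : (\int[_]_(x in _) _)%E = \int[@lebesgue_measure R]_(t in circ)
    limn_einf (fun N => (G N t)%:E))%E; last first.
  apply: eq_integral => t _; have [-> _] := cvg_limn_einf_sup (cvgG t).
  by [].
have mcirc : measurable circ by exact: measurable_itv.
have G0 N t : circ t -> (0 <= (G N t)%:E)%E by move=> _; rewrite lee_fin sqr_ge0.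
apply: le_trans (fatou (@lebesgue_measure R) mcirc mG G0) _.
rewrite limn_einf_lim; apply: lime_le; first exact: is_cvg_einfs.
apply: nearW => N; apply: le_trans (intG N); apply: ereal_inf_lbound.
by exists N => /=; [exact: leqnn|].
Qed.

End bounded_projection.

(** * Passage to the limit *)

Section reduction.
Context {R : realType}.
Local Notation D := (@disk R 1).

Lemma Linfty_norm_ge0 (mu : R[i] -> R[i]) : (0 <= Linfty_norm mu)%E.
Proof.
rewrite /Linfty_norm; apply: ess_sup_gee.
  apply: (@lt_le_trans _ _ (area R D)); first by rewrite area_disk// expr1n lte_fin.
  by apply: le_measure; rewrite ?inE//; exact: measurable_disk.
apply: nearW => p /=; rewrite lee_fin patchE; case: ifPn => // _; exact: normc_ge0.
Qed.

(** A density in [L^oo] is bounded by its norm after a change on a null set,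
    and this change does not affect the projection on the open disk. *)
Lemma bounded_representative (mu : R[i] -> R[i]) : in_Linfty mu ->
  exists nu : R[i] -> R[i],
    [/\ cmeasurable_fun D (fun p => nu (to_complex p)),
        forall p, D p -> cmod (nu (to_complex p)) <= fine (Linfty_norm mu) &
        forall z, cmod z < 1 -> bergman nu z = bergman mu z].
Proof.
move=> [m1 m2 moo].
set M := fine (Linfty_norm mu).
have ME : Linfty_norm mu = M%:E by rewrite /M fineK// ge0_fin_numE ?Linfty_norm_ge0.
have M0 : 0 <= M by rewrite -lee_fin -ME Linfty_norm_ge0.
have mD : measurable D by exact: measurable_disk.
have mmu : cmeasurable_fun D (fun p => mu (to_complex p)) by [].
pose nu z := if cmod (mu z) <= M then mu z else 0.
have mcond : measurable_fun D (fun p => cmod (mu (to_complex p)) <= M).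
  apply: measurable_fun_ler; last exact: measurable_cst.
  exact: measurable_fun_normc.
have mnu : cmeasurable_fun D (fun p => nu (to_complex p)).
  have h (f : plane R -> R) : measurable_fun D f ->
      measurable_fun D (fun p => if cmod (mu (to_complex p)) <= M then f p else 0).
    by move=> mf; apply: measurable_fun_if => //; exact: measurable_funS mf.
  split; [have := h _ m1|have := h _ m2]; congr measurable_fun;
    by apply/funext => p; rewrite /nu; case: ifP.
exists nu; split => //.
  by move=> p _; rewrite /nu; case: ifPn => // _; rewrite ComplexField.Normc.normc0.
move=> z z1.
have aeM : {ae area R, forall p, D p -> nu (to_complex p) = mu (to_complex p)}.
  have := ess_sup_ge (area R) (EFin \o ((fun p => cmod (mu (to_complex p))) \_ D)).
  apply: filterS => p /=; rewrite -/(Linfty_norm mu) ME lee_fin patchE => + Dp.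
  by rewrite mem_set// /nu => ->.
have mK := cmeasurable_kernel z1.
have mI := cmeasurable_funM mmu mK.
have mJ := cmeasurable_funM mnu mK.
rewrite /bergman /cintegral; congr (_ +i* _); congr fine; apply: ae_eq_integral => //.
- by apply/measurable_EFinP; exact: mJ.1.
- by apply/measurable_EFinP; exact: mI.1.
- by apply: filterS aeM => p /= + Dp => ->.
- by apply/measurable_EFinP; exact: mJ.2.
- by apply/measurable_EFinP; exact: mI.2.
- by apply: filterS aeM => p /= + Dp => ->.
Qed.

End reduction.

Theorem theorem1p5p4 (R : realType) (mu g : R[i] -> R[i])
    (mu_Linfty : in_Linfty mu)
    (gE : forall z : R[i], cmod z < 1 -> g z = bergman mu z) :
  (limf_esup
     (fun r : R => ((log_weight r)^-1%:E *
        circle_integral (fun zeta => cmod (dilate g r zeta) ^+ 2)%R))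
     (1 : R)^'-
   <= (1 - rhoH R) * Linfty_norm mu ^+ 2)%E.
Proof.
have [nu [mnu nuM bE]] := bounded_representative mu_Linfty.
have [m1 m2 moo] := mu_Linfty.
set M := fine (Linfty_norm mu) in nuM.
have ME : Linfty_norm mu = M%:E by rewrite /M fineK// ge0_fin_numE ?Linfty_norm_ge0.
have M0 : 0 <= M by rewrite -lee_fin -ME Linfty_norm_ge0.
pose phi (r : R) : \bar R := ((log_weight r)^-1%:E *
        circle_integral (fun zeta => cmod (dilate g r zeta) ^+ 2)%R)%E.
(* The estimate on each circle. *)
have phi_le r : 0 < r < 1 ->
    (phi r <= ((M / r ^+ 2) ^+ 2 * (1 - fine (rho_at r)))%:E)%E.
  move=> r01; have L0 := log_weight_gt0 r01; have /andP[r0 r1] := r01.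
  have -> : phi r = ((log_weight r)^-1%:E *
      circle_integral (fun zeta => cmod (dilate (bergman nu) r zeta) ^+ 2)%R)%E.
    rewrite /phi /circle_integral; congr (_ * (_ * _))%E; apply: eq_integral => t _.
    congr ((cmod _ ^+ 2)%:E); rewrite /dilate gE ?bE//;
    by rewrite -/(expi t) ComplexField.Normc.normcM normc_expi mulr1 normc_real ger0_norm// ltW.
  rewrite lee_pdivrMl// -EFinM.
  have := circle_integral_bergman_le mnu nuM r01.
  by rewrite [(log_weight r * _)%R]mulrC.
have rho01 : (\forall r \near (1 : R)^'-, 0 < r < 1).
  near=> r; apply/andP; split; last by near: r; exact: nbhs_left_lt.
  by near: r; apply: nbhs_left_gt.
have rhoHE : rhoH R = ereal_sup [set ereal_inf (@rho_at R @` V) | V in (1 : R)^'-].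
  exact: limf_einfE.
have rho_ge0 : (0 <= rhoH R)%E.
  rewrite rhoHE; apply: (@le_trans _ _ (ereal_inf (@rho_at R @` [set r | 0 < r < 1]))).
    by apply: le_ereal_inf_tmp => _ [r r01 <-]; exact: rho_at_ge0.
  by apply: ereal_sup_ubound; exists [set r | 0 < r < 1].
have rho_le1 : (rhoH R <= 1)%E.
  rewrite rhoHE; apply: ge_ereal_sup => _ [V FV <-].
  have [r [Vr r01]] := filter_ex (filterI FV rho01).
  apply: (@le_trans _ _ (rho_at r)); last exact: rho_at_le1.
  by apply: ereal_inf_lbound; exists r.
pose rho := fine (rhoH R).
have rhoE : rhoH R = rho%:E.
  by rewrite /rho fineK// ge0_fin_numE// (le_lt_trans rho_le1)// ltry.
have rho0 : 0 <= rho by rewrite -lee_fin -rhoE.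
have rho1 : rho <= 1 by rewrite -lee_fin -rhoE.
rewrite ME rhoE -EFinB -EFin_expe -EFinM.
apply/lee_addgt0Pr => e e0.
(* The loss in [r ^- 4] and in the lower limit is at most [31 * d * M ^+ 2]. *)
have Me : 0 < M ^+ 2 + e by rewrite ltr_wpDl// sqr_ge0.
pose d := e / (31 * (M ^+ 2 + e)).
have d0 : 0 < d by rewrite divr_gt0// mulr_gt0.
have d1 : d <= 1.
  rewrite ler_pdivrMr ?mulr_gt0// mul1r.
  have := sqr_ge0 M; lra.
have dM : 31 * d * M ^+ 2 <= e.
  rewrite /d (_ : 31 * _ * _ = e * (M ^+ 2 / (M ^+ 2 + e))).
    by rewrite ler_piMr ?(ltW e0)// ler_pdivrMr// mul1r lerDl (ltW e0).
  by field; rewrite gt_eqF.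
have [V FV rhoV] : exists2 V : set R, (1 : R)^'- V & forall r, V r -> ((rho - d)%:E <= rho_at r)%E.
  have : ((rho - d)%:E < rhoH R)%E by rewrite rhoE lte_fin ltrBlDr ltrDl.
  rewrite rhoHE => /ereal_sup_gt[_ [V FV <-]] lt_inf.
  exists V => // r Vr; apply: le_trans (ltW lt_inf) _.
  by apply: ereal_inf_lbound; exists r.
have near_inv : \forall r \near (1 : R)^'-, (1 + d)^-1 < r.
  by apply: nbhs_left_gt; rewrite invf_lt1 ?ltrDl// addr_gt0.
pose W := [set r | [/\ V r, 0 < r < 1 & (1 + d)^-1 < r]].
have FW : (1 : R)^'- W.
  by near=> r; split; near: r.
rewrite limf_esupE; apply: (@le_trans _ _ (ereal_sup (phi @` W))).
  by apply: ereal_inf_lbound; exists W.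
apply: ge_ereal_sup => _ [r [Vr r01 dr] <-].
apply: le_trans (phi_le r r01) _; rewrite -EFinD lee_fin.
have /andP[r0 r1] := r01.
have rho_r : rho - d <= fine (rho_at r).
  rewrite -lee_fin fineK; first exact: rhoV.
  by rewrite ge0_fin_numE ?rho_at_ge0// (le_lt_trans (rho_at_le1 r01))// ltry.
have rho_r1 : fine (rho_at r) <= 1.
  rewrite -lee_fin fineK; first exact: rho_at_le1.
  by rewrite ge0_fin_numE ?rho_at_ge0// (le_lt_trans (rho_at_le1 r01))// ltry.
have inv_r : r^-1 <= 1 + d.
  by rewrite -[leRHS]invrK lef_pV2 ?posrE// ?invr_gt0 ?addr_gt0// ltW.
have inv_r4 : (r^-1) ^+ 4 <= 1 + 15 * d.
  apply: (@le_trans _ _ ((1 + d) ^+ 4)).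
    by rewrite lerXn2r ?nnegrE ?invr_ge0 ?addr_ge0// ltW.
  have d2 : d ^+ 2 <= d by rewrite expr2 ler_piMr// ltW.
  have d3 : d ^+ 3 <= d.
    by rewrite exprS -[leRHS]mulr1 ler_wpM2l ?(ltW d0)// (le_trans d2).
  have d4 : d ^+ 4 <= d.
    by rewrite exprS -[leRHS]mulr1 ler_wpM2l ?(ltW d0)// (le_trans d3).
  have -> : (1 + d) ^+ 4 = 1 + 4 * d + 6 * d ^+ 2 + 4 * d ^+ 3 + d ^+ 4 by ring.
  lra.
have -> : (M / r ^+ 2) ^+ 2 = M ^+ 2 * (r^-1) ^+ 4 by field; rewrite gt_eqF.
apply: (@le_trans _ _ (M ^+ 2 * ((1 - rho) + 31 * d))); last first.
  by rewrite mulrDr (mulrC (M ^+ 2) (1 - rho)) lerD2l mulrC.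
rewrite -mulrA ler_wpM2l ?sqr_ge0//.
apply: (@le_trans _ _ ((1 + 15 * d) * (1 - rho + d))).
  apply: ler_pM => //; first by rewrite exprn_ge0// invr_ge0 ltW.
    by rewrite subr_ge0.
  lra.
have d2 : d ^+ 2 <= d by rewrite expr2 ler_piMr// ltW.
have : 0 <= d * rho by rewrite mulr_ge0// ltW.
nra.
Unshelve. all: by end_near. Qed.
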